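(* Let $M$ be an Abelian subgroup of maximal order of $W=W(E_7)$; then $M\cong\mathbb{Z}_2^7$ and $M$ is generated by the reflections $s_{\beta_1},\dots,s_{\beta_7}$ in seven pairwise (strongly) orthogonal roots, these being the only reflections in $M$. Consider the action of $M$ on the $56$ weights of the $56$-dimensional minuscule representation of $E_7$. Then: (i) $M$ has exactly seven orbits, each of size $8$, and the incidence structure whose points are the seven reflections $s_{\beta_i}$ and whose lines are the seven orbits, with $s_{\beta_i}$ incident to an orbit $O$ iff $\langle\beta_i,\lambda\rangle\neq0$ for the weights $\lambda\in O$, is a Fano plane (each line contains three points, each point lies on three lines, any two points lie on exactly one line). (ii) The discrete Weyl group $N_W(M)/M$ is isomorphic to $PSL(2,7)$.
   Context: $\langle\cdot,\cdot\rangle$ is the $W$-invariant inner product on the ambient space of the roots and weights. $N_W(M)$ denotes the normalizer of $M$ in $W$. The Fano plane is the projective plane of order $2$ (7 points, 7 lines). *)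

(* Defs.v *)
From HB Require Import structures.
From mathcomp Require Import all_boot all_order all_algebra all_fingroup all_solvable.
Set Implicit Arguments. Unset Strict Implicit. Unset Printing Implicit Defensive.
Import GRing.Theory Num.Theory.

Local Open Scope ring_scope.

(* Ambient space: Q^8 (row vectors); E7 lives in the hyperplane orthogonal to
   (1,...,1), on which the standard dot product is the W-invariant form. *)
Definition vec := 'rV[rat]_8.

Definition ip (u v : vec) : rat := \sum_(k < 8) u 0 k * v 0 k.

Definition shvec (S : {set 'I_8}) (c : rat) : vec :=
  \row_k ((k \in S)%:R - c).

Definition unitv (i : 'I_8) : vec := \row_k (i == k)%:R.

Definition rootsE7 : seq vec :=
  [seq unitv i - unitv j | i <- enum 'I_8, j <- [seq j <- enum 'I_8 | j != i]]
  ++ [seq shvec A (2%:R)^-1 | A <- enum [set S : {set 'I_8} | #|S| == 4%N]].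

Definition weights56 : seq vec :=
  [seq s *: shvec A (4%:R)^-1 | s <- [:: 1; -1],
                                A <- enum [set S : {set 'I_8} | #|S| == 2%N]].

Definition refl (b v : vec) : vec := v - ((2%:R * ip v b) / ip b b) *: b.

(* finite carrier: roots and weights; W acts faithfully by permutations *)
Definition X : finType := seq_sub (rootsE7 ++ weights56).

(* the permutation of X induced by the reflection s_b (identity if s_b does
   not permute X, which never happens for b a root) *)
Definition reflp (b : vec) : {perm X} :=
  odflt 1%g [pick g : {perm X} | [forall x, val (g x) == refl b (val x)]].

Definition reflections : {set {perm X}} :=
  [set reflp (val x) | x in [pred x : X | val x \in rootsE7]].

Definition WE7 : {group {perm X}} := (<<reflections>>)%G.

Definition weightX : {set X} := [set x : X | val x \in weights56].

Definition SL27 : {group {'GL_2['F_7]}} :=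
  (<<[set g : {'GL_2['F_7]} | \det (GLval g) == (1 : 'F_7)%R]>>)%G.
Definition PSL27 := (SL27 / 'Z(SL27))%g.

(* Main.v *)
(** Let A be an abelian subgroup of W of order at least 128.  If A had an element g of odd
    prime order, choose a weight x moved by g: the stabiliser B of x in A fixes the whole
    orbit A x, in particular the three weights x, gx, g^2 x.  Up to sign and the action of W
    there are two such triples, with stabilisers W(A4) and W(D4); an abelian B in either is
    small compared with the number of weights it fixes, and |A| = |A x| |B| < 128.  So A is
    a 2-group, and as there are 135 = 27 * 5 frames of seven orthogonal root lines, A
    preserves a frame.  An abelian group acting on seven points satisfies
    |image| * 2^(number of orbits) <= 2^7, with equality only if it is trivial or contains a
    transposition, and no element of W induces a transposition on a frame, whence A is the
    group of sign changes of the frame.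

    For the normaliser, take the frame of the roots attached to the words of weight four of
    the extended quadratic residue code of length 8, with coordinates indexed by P^1(F_7):
    PSL(2,7) permutes the coordinates and preserves the code, and it is transitive on the
    ordered triangles of the Fano plane. *)

Require Import Defs.
From HB Require Import structures.
From mathcomp Require Import all_boot all_order all_algebra all_fingroup all_solvable.
From mathcomp Require Import ring zify.
Import GRing.Theory Num.Theory.
Set Implicit Arguments. Unset Strict Implicit. Unset Printing Implicit Defensive.

(** W has 2903040 elements and is never enumerated: only roots, weights, frames and the matrices of
    SL(2,7) are, and elements of W enter as products of reflections. Conjugacy of triples of weights
    rests on one remark: two weights with inner product 1/2 differ by a root, whose reflection
    exchanges them and fixes every vector having equal products with both. Weights serve for the odd
    primes because two weights that are neither equal nor opposite have inner product 1/2 or -1/2,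
    and because an element of odd order sends no weight to its opposite. Up to signs, a triple then
    has a single invariant, the sign of the product of its three inner products. A 2-group fixes a
    frame because 135 is odd. The kernel of the action of A on the frame consists of sign changes
    that commute with A, hence are constant on the orbits of A; this is the origin of the factor
    2^(number of orbits). *)

(** * Abelian groups acting on finite sets *)

Section AbelianActions.
Variables (aT : finGroupType) (rT : finType) (to : {action aT &-> rT}).
Implicit Types (A : {group aT}) (S : {set rT}).
Local Open Scope group_scope.

(** The induction step of both bounds below. By commutativity the stabiliser of [x] fixes the whole
    orbit of [x], so the orbit can be removed from [S] when [A] is replaced by that stabiliser. *)
Lemma acts_stab_setD A S x : abelian A -> [acts A, on S | to] -> x \in S ->
  [/\ [acts 'C_A[x | to], on S :\: orbit to A x | to],
      'C_A(S | to) = 'C_('C_A[x | to])(S :\: orbit to A x | to),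
      orbit to A x \subset S
    & forall a y, a \in 'C_A[x | to] -> y \in orbit to A x -> to y a = y].
Proof.
move=> abA actS xS; have sO : orbit to A x \subset S by rewrite acts_sub_orbit.
have actO : [acts A, on orbit to A x | to] by apply: acts_orbit; rewrite subsetT.
have sA1 : 'C_A[x | to] \subset A by rewrite subsetIl.
have fixO a y : a \in 'C_A[x | to] -> y \in orbit to A x -> to y a = y.
  rewrite !inE sub1set inE => /andP[aA /eqP fx] /imsetP[b bA ->].
  by rewrite -actM (centsP abA _ bA _ aA) actM fx.
split=> //.
  apply/subsetP => a aA; rewrite !inE; apply/subsetP => y; rewrite !inE => /andP[nO yS].
  have aA' := subsetP sA1 _ aA.
  by rewrite (acts_act actS) // (acts_act actO) // nO yS.
apply/setP => a; apply/setIP/setIP => [[aA ca]|[aA1 ca]].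
  split; last by apply: subsetP ca; apply: astabS; rewrite subsetDl.
  by apply/setIP; split=> //; apply: subsetP ca; apply: astabS; rewrite sub1set.
split; first exact: (subsetP sA1).
apply/astabP => y yS; have [yO|nO] := boolP (y \in orbit to A x); first exact: fixO yO.
by apply: (astabP ca); rewrite inE nO.
Qed.

(** An orbit of size n contributes a factor n to the order, and n^(1/n) is largest at n = 3, where
    equality holds. *)
Lemma cube_le_exp3 n : (n ^ 3 <= 3 ^ n)%N.
Proof.
case: n => [|[|[|n]]] //; elim: n => [//|n IH].
have h : (n.+4 ^ 3 <= 3 * n.+3 ^ 3)%N by clear; rewrite !expnS expn0; nia.
by apply: leq_trans h _; rewrite [leqRHS]expnS leq_mul2l IH.
Qed.

(** The index is the order of the permutation group induced on [S]; cubing keeps the bound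
    3^(#|S|/3) among the naturals. *)
Lemma abelian_index_cube A S : abelian A -> [acts A, on S | to] ->
  (#|A : 'C_A(S | to)| ^ 3 <= 3 ^ #|S|)%N.
Proof.
have [n] := ubnP #|S|; elim: n => // n IH in A S *; rewrite ltnS => leSn abA actS.
have [->|[x xS]] := set_0Vmem S.
  rewrite (_ : 'C_A(set0 | to) = A) ?indexgg ?cards0 //.
  by apply/setIidPl/subsetP => a _; apply/astabP => y; rewrite inE.
have [act1 eC sO fixO] := acts_stab_setD abA actS xS.
have sA1 : 'C_A[x | to] \subset A by rewrite subsetIl.
have xO := orbit_refl to A x.
have cS : #|S| = (#|orbit to A x| + #|S :\: orbit to A x|)%N.
  by rewrite -(cardsID (orbit to A x) S) (setIidPr sO).
have lt1 : (#|S :\: orbit to A x| < n)%N.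
  apply: leq_trans leSn; rewrite cS -[X in (X < _)%N]add0n ltn_add2r card_gt0.
  by apply/set0Pn; exists x.
have ih := IH _ _ lt1 (abelianS sA1 abA) act1.
rewrite eC -(Lagrange_index sA1 (subsetIl _ _)) expnMn cS expnD -card_orbit.
by apply: leq_mul => //; apply: cube_le_exp3.
Qed.

Definition no_transposition A S := forall a x y, a \in A -> x \in S -> to x a = y -> y != x ->
  exists z, [/\ z \in S, z != x, z != y & to z a != z].

(** An orbit of size k contributes k to the index and one factor 2 for itself, against 2^k on the
    right. Orbits of size at least 3 thus give strictness at once, and only orbits of size 2 need a
    further argument. *)
Lemma mul2_le_exp k : (2 * k <= 2 ^ k)%N /\ ((2 < k)%N -> (2 * k < 2 ^ k)%N).
Proof.
case: k => [|[|[|k]]] //; split=> //.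
  by elim: k => [//|k IH]; rewrite expnS; move: IH; lia.
by elim: k => [//|k IH] _; rewrite expnS; have := IH isT; lia.
Qed.

Lemma abelian_index_orbits A S : abelian A -> [acts A, on S | to] ->
  ((#|A : 'C_A(S | to)| * 2 ^ #|orbit to A @: S| <= 2 ^ #|S|)%N) /\
  (no_transposition A S -> ~~ (A \subset 'C(S | to)) ->
   (#|A : 'C_A(S | to)| * 2 ^ #|orbit to A @: S| < 2 ^ #|S|)%N).
Proof.
have [n] := ubnP #|S|; elim: n => // n IH in A S *; rewrite ltnS => leSn abA actS.
have triv : A \subset 'C(S | to) ->
    (#|A : 'C_A(S | to)| * 2 ^ #|orbit to A @: S| <= 2 ^ #|S|)%N.
  by move=> /setIidPl ->; rewrite indexgg mul1n leq_exp2l // leq_imset_card.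
have [sC|nC] := boolP (A \subset 'C(S | to)); first by split=> //; apply: triv.
suff [h1 h2] : ((#|A : 'C_A(S | to)| * 2 ^ #|orbit to A @: S| <= 2 ^ #|S|)%N) /\
  (no_transposition A S -> (#|A : 'C_A(S | to)| * 2 ^ #|orbit to A @: S| < 2 ^ #|S|)%N).
  by split=> // nt _; apply: h2.
have /subsetPn[a aA naC] := nC.
have [x xS nx] : exists2 x, x \in S & to x a != x.
  apply/exists_inP; apply: contraR naC => /exists_inPn h; apply/astabP => y yS.
  by have := h y yS; rewrite negbK => /eqP.
have [act1 eC sO fixO] := acts_stab_setD abA actS xS.
have sA1 : 'C_A[x | to] \subset A by rewrite subsetIl.
set O := orbit to A x in act1 eC sO fixO *; set S' := S :\: O in act1 eC *.
have xO : x \in O := orbit_refl to A x.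
have xaO : to x a \in O by apply: mem_orbit.
have cS : #|S| = (#|O| + #|S'|)%N by rewrite -(cardsID O S) (setIidPr sO).
have c2 : #|[set x; to x a]| = 2 by rewrite cards2 eq_sym nx.
have sO2 : [set x; to x a] \subset O by apply/subsetP => z /set2P[]->.
have k2 : (2 <= #|O|)%N by rewrite -{1}c2 subset_leq_card.
have lt1 : (#|S'| < n)%N by apply: leq_trans leSn; rewrite cS -[X in (X < _)%N]add0n ltn_add2r (leq_trans _ k2).
have [ih1 ih2] := IH _ _ lt1 (abelianS sA1 abA) act1.
have orbS : (#|orbit to A @: S| <= 1 + #|orbit to A @: S'|)%N.
  apply: leq_trans (_ : (#|O |: orbit to A @: S'| <= _)%N); last first.
    by rewrite cardsU1 leq_add2r; case: (_ \notin _).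
  apply: subset_leq_card; apply/subsetP => _ /imsetP[y yS ->]; rewrite in_setU1.
  have [yO|nO] := boolP (y \in O); first by rewrite (orbit_eqP yO) eqxx.
  by rewrite imset_f ?orbT // inE nO.
have orb1 : (#|orbit to A @: S'| <= #|orbit to 'C_A[x | to] @: S'|)%N.
  (* [f] sends an orbit of the stabiliser to the orbit of [A] containing it, so the stabiliser has
     at least as many orbits. The default [x] is never taken, orbits being nonempty. *)
  pose f (E : {set rT}) := orbit to A (odflt x [pick y in E]).
  apply: leq_trans (leq_imset_card f _); apply: subset_leq_card.
  apply/subsetP => _ /imsetP[y yS ->]; apply/imsetP; exists (orbit to 'C_A[x | to] y).
    exact: imset_f.
  rewrite /f; case: pickP => [z /= zO|/(_ y)]; last by rewrite /= orbit_refl.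
  apply/esym/orbit_eqP; case/imsetP: zO => b bA ->.
  by apply: mem_orbit; apply: (subsetP sA1).
have idx : #|A : 'C_A(S | to)| = (#|O| * #|'C_A[x | to] : 'C_('C_A[x | to])(S' | to)|)%N.
  by rewrite eC -(Lagrange_index sA1 (subsetIl _ _)) -card_orbit.
have [kk kk'] := mul2_le_exp #|O|.
have p1 : (2 ^ #|orbit to A @: S| <= 2 * 2 ^ #|orbit to A @: S'|)%N.
  by rewrite -expnS leq_exp2l.
have p2 : (2 ^ #|orbit to A @: S'| <= 2 ^ #|orbit to 'C_A[x | to] @: S'|)%N.
  by rewrite leq_exp2l.
have le1 (k i : nat) : (k * i * 2 ^ #|orbit to A @: S| <=
    (2 * k) * (i * 2 ^ #|orbit to 'C_A[x | to] @: S'|))%N.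
  rewrite -mulnA [(2 * k)%N]mulnC -mulnA leq_mul2l mulnCA leq_mul2l.
  by rewrite (leq_trans p1) ?orbT // leq_mul2l p2 orbT.
have s0 : (0 < 2 ^ #|S'|)%N by rewrite expn_gt0.
rewrite idx cS expnD; split; first by apply: leq_trans (le1 _ _) _; apply: leq_mul.
move=> nt; have [k3|k3] := ltnP 2 #|O|.
  apply: leq_ltn_trans (le1 _ _) _.
  apply: leq_ltn_trans (leq_mul (leqnn _) ih1) _.
  by rewrite ltn_pmul2r // kk'.
have eO : #|O| = 2 by apply/eqP; rewrite eqn_leq k2 k3.
have [sC1|nC1] := boolP ('C_A[x | to] \subset 'C(S' | to)); last first.
  (* The hypothesis passes to [S']: the further point that [b] moves cannot lie in [O], which the
     stabiliser fixes pointwise. *)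
  have nt1 : no_transposition 'C_A[x | to] S'.
    move=> b u v bA /setDP[uS uO] uv vu.
    have [z [zS zu zv zb]] := nt b u v (subsetP sA1 _ bA) uS uv vu.
    exists z; split=> //; rewrite inE zS andbT; apply: contra zb => zO.
    by rewrite (fixO _ _ bA zO).
  by apply: leq_ltn_trans (le1 _ _) _; rewrite eO ltn_pmul2l // ih2.
have -> : #|'C_A[x | to] : 'C_('C_A[x | to])(S' | to)| = 1%N.
  by rewrite (setIidPl sC1) indexgg.
(* Here the stabiliser acts trivially on [S'], so strictness has to come from the orbit count: [a]
   moves a point [z] of [S'], hence [A] has fewer orbits on [S'] than [S'] has points. *)
have [z [zS zx zxa za]] := nt a x _ aA xS (erefl _) nx.
have OE : O = [set x; to x a] by apply/esym/eqP; rewrite eqEcard sO2 c2 eO.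
have zS' : z \in S' by rewrite inE zS OE !inE negb_or zx zxa.
have zaO : to z a \in orbit to A z by apply: mem_orbit.
have zaS' : to z a \in S'.
  rewrite inE (acts_act actS) // zS andbT; apply: contraL zS' => zO.
  by rewrite inE negb_and negbK /O -(orbit_eqP zO) (orbit_eqP zaO) orbit_refl.
have lo : (#|orbit to A @: S'| < #|S'|)%N.
  rewrite ltn_neqAle leq_imset_card andbT; apply: contra za => /imset_injP inj.
  by apply/eqP; apply: inj => //; apply: orbit_eqP.
have h2 : (2 * 2 ^ #|orbit to A @: S'| <= 2 ^ #|S'|)%N by rewrite -expnS leq_exp2l.
rewrite eO muln1 -[(2 ^ 2)%N]/(2 * 2)%N -mulnA ltn_pmul2l //; apply: leq_ltn_trans p1 (leq_ltn_trans h2 _).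
by rewrite -[X in (X < _)%N]mul1n ltn_pmul2r.
Qed.

End AbelianActions.

Local Open Scope ring_scope.

(** * Roots and weights as integer vectors *)

(* A vector of [vec] is represented by the list of its coordinates multiplied by 4. *)
Definition code := seq int.

Definition dec (c : code) : vec := \row_k ((nth 0 c k)%:~R / 4%:R).

(** The operations of [int] are named directly, not through its ring structure, for the sake of
    evaluation. *)
Fixpoint dot (c d : code) : int :=
  if c is a :: c' then if d is b :: d' then
    intZmod.addz (intRing.mulz a b) (dot c' d') else Posz 0 else Posz 0.

Fixpoint bitlists (n : nat) : seq bitseq :=
  if n is n'.+1 then
    [seq true :: s | s <- bitlists n'] ++ [seq false :: s | s <- bitlists n']
  else [:: [::]].

Definition two_val (a b : int) (s : bitseq) : code :=
  [seq if e then a else b | e <- s].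

(** [Negz n] is -(n + 1): [Negz 3] is -4, and the [Negz 1] and [Negz 0] below are -2 and -1. *)
Definition diff_code (i j : nat) : code :=
  mkseq (fun k => if k == i then Posz 4 else if k == j then Negz 3 else Posz 0) 8.

Definition subsets_code (m : nat) : seq bitseq :=
  [seq s <- bitlists 8 | count id s == m].

#[global] Arguments subsets_code : simpl never.

Definition root_codes : seq code :=
  [seq diff_code i j | i <- iota 0 8, j <- [seq j <- iota 0 8 | j != i]]
  ++ [seq two_val (Posz 2) (Negz 1) s | s <- subsets_code 4].

Definition weight_codes : seq code :=
  [seq two_val (Posz 3) (Negz 0) s | s <- subsets_code 2]
  ++ [seq two_val (Negz 2) (Posz 1) s | s <- subsets_code 2].

Definition codes := root_codes ++ weight_codes.

Lemma size_codes : all (fun c => size c == 8)%N codes.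
Proof. by vm_compute. Qed.

Lemma ip_dec c d : size c = 8%N -> size d = 8%N ->
  ip (dec c) (dec d) = (dot c d)%:~R / 16%:R.
Proof.
case: c => [|c0 [|c1 [|c2 [|c3 [|c4 [|c5 [|c6 [|c7 [|? ?]]]]]]]]] // _.
case: d => [|d0 [|d1 [|d2 [|d3 [|d4 [|d5 [|d6 [|d7 [|? ?]]]]]]]]] // _.
rewrite /ip !big_ord_recr big_ord0 /= !mxE /=.
rewrite -[intZmod.addz]/(@GRing.add int) -[intRing.mulz]/(@GRing.mul int).
by rewrite !(rmorphD, rmorphM) /=; field.
Qed.

Lemma dec_injective c d : size c = 8%N -> size d = 8%N -> dec c = dec d -> c = d.
Proof.
move=> sc sd /rowP e; apply: (@eq_from_nth _ 0); rewrite ?sc ?sd // => i li.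
have := e (Ordinal li); rewrite !mxE /= => /(mulIf _) h.
by apply: (@intr_inj rat); apply: h.
Qed.

Lemma mem_bitlists s : s \in bitlists (size s).
Proof.
elim: s => //= b s IH; rewrite mem_cat.
by case: b; apply/orP; [left|right]; apply: map_f.
Qed.

Lemma size_bitlists n s : s \in bitlists n -> size s = n.
Proof.
elim: n s => [|n IH] s /=; first by rewrite inE => /eqP->.
by rewrite mem_cat => /orP[] /mapP[t /IH <- ->].
Qed.

Definition bits_of (A : {set 'I_8}) : bitseq := mkseq (fun k => inord k \in A) 8.

Lemma count_bits (A : {set 'I_8}) : count id (bits_of A) = #|A|.
Proof.
rewrite /bits_of -[mkseq _ 8]/(map _ (iota 0 8)) -val_enum_ord -map_comp count_map.
rewrite cardE -size_filter {2}/enum_mem -enumT; congr size.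
by apply: eq_filter => k /=; rewrite inord_val.
Qed.

Lemma bits_ofK (s : bitseq) : size s = 8%N -> bits_of [set k : 'I_8 | nth false s k] = s.
Proof.
move=> ss; apply: (@eq_from_nth _ false); rewrite size_mkseq // => i li.
by rewrite nth_mkseq // inE inordK.
Qed.

Lemma mem_subsets_code m s :
  (s \in subsets_code m) = (s \in [seq bits_of A | A <- enum [set S : {set 'I_8} | #|S| == m]]).
Proof.
rewrite mem_filter; apply/andP/mapP => [[cs bs]|[A]].
  have ss := size_bitlists bs.
  by exists [set k : 'I_8 | nth false s k]; rewrite ?mem_enum ?inE ?bits_ofK -?count_bits ?bits_ofK.
rewrite mem_enum inE => cA ->; rewrite count_bits; split=> //.
by have := mem_bitlists (bits_of A); rewrite size_mkseq.
Qed.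

Lemma dec_two_val a b A (r c : rat) :
  a%:~R / 4%:R = r * (1 - c) -> b%:~R / 4%:R = - (r * c) ->
  dec (two_val a b (bits_of A)) = r *: shvec A c.
Proof.
move=> ea eb; apply/rowP => k; rewrite !mxE (nth_map false) ?size_mkseq //.
rewrite nth_mkseq // inord_val; case: (k \in A); first by rewrite ea.
by rewrite eb sub0r mulrN.
Qed.

Lemma dec_diff_code (i j : 'I_8) : i != j -> dec (diff_code i j) = unitv i - unitv j.
Proof.
move=> nij; apply/rowP => k; rewrite !mxE nth_mkseq // !(eq_sym _ k).
rewrite -!(inj_eq val_inj) /=.
case: eqP => [->|_]; last by case: eqP => _ /=; field.
by rewrite (inj_eq val_inj) (negPf nij) /=; field.
Qed.

Lemma rootsE7_dec : rootsE7 =i [seq dec c | c <- root_codes].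
Proof.
move=> v; rewrite /rootsE7 /root_codes map_cat !mem_cat; congr (_ || _).
  apply/allpairsPdep/mapP => [[i [j [_]]]|[c /allpairsPdep[i [j []]]]].
    rewrite mem_filter => /andP[nji _] ->.
    exists (diff_code i j); last by rewrite dec_diff_code // eq_sym.
    apply/allpairsPdep; exists (val i), (val j); split=> //; rewrite ?mem_filter ?mem_iota ?ltn_ord //=.
    by rewrite ?andbT.
  rewrite mem_filter !mem_iota /= => li /andP[nji lj] -> ->.
  exists (Ordinal li), (Ordinal lj); split; rewrite ?mem_enum //.
    by rewrite mem_filter mem_enum -(inj_eq val_inj) /= nji.
  rewrite -[diff_code i j]/(diff_code (Ordinal li) (Ordinal lj)) dec_diff_code //.
  by rewrite -(inj_eq val_inj) eq_sym.
have e A : dec (two_val (Posz 2) (Negz 1) (bits_of A)) = shvec A 2%:R^-1.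
  by rewrite (@dec_two_val _ _ _ 1 2%:R^-1) ?scale1r //; field.
rewrite -map_comp; apply/mapP/mapP => [[A hA ->]|[s]].
  by exists (bits_of A); rewrite /= ?e // mem_subsets_code; apply: map_f.
by rewrite mem_subsets_code => /mapP[A hA ->] ->; exists A => //=; rewrite e.
Qed.

Lemma weights56_dec : weights56 =i [seq dec c | c <- weight_codes].
Proof.
have e A : dec (two_val (Posz 3) (Negz 0) (bits_of A)) = 1 *: shvec A 4%:R^-1.
  by rewrite (@dec_two_val _ _ _ 1 4%:R^-1) //; field.
have e' A : dec (two_val (Negz 2) (Posz 1) (bits_of A)) = -1 *: shvec A 4%:R^-1.
  by rewrite (@dec_two_val _ _ _ (-1) 4%:R^-1) //; field.
have h1 : [seq 1 *: shvec A 4%:R^-1 | A <- enum [set S : {set 'I_8} | #|S| == 2%N]]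
    =i [seq dec c | c <- [seq two_val (Posz 3) (Negz 0) s | s <- subsets_code 2]].
  move=> v; rewrite -map_comp; apply/mapP/mapP => [[A hA ->]|[s]].
    by exists (bits_of A); rewrite /= ?e // mem_subsets_code; apply: map_f.
  by rewrite mem_subsets_code => /mapP[A hA ->] ->; exists A => //=; rewrite e.
have h2 : [seq -1 *: shvec A 4%:R^-1 | A <- enum [set S : {set 'I_8} | #|S| == 2%N]]
    =i [seq dec c | c <- [seq two_val (Negz 2) (Posz 1) s | s <- subsets_code 2]].
  move=> v; rewrite -map_comp; apply/mapP/mapP => [[A hA ->]|[s]].
    by exists (bits_of A); rewrite /= ?e' // mem_subsets_code; apply: map_f.
  by rewrite mem_subsets_code => /mapP[A hA ->] ->; exists A => //=; rewrite e'.
move=> v; rewrite /weights56 /allpairs [map _ [:: _; _]]/= [flatten _]/= cats0.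
by rewrite mem_cat h1 h2 -mem_cat -map_cat.
Qed.

Lemma mem_X v : (v \in rootsE7 ++ weights56) = (v \in [seq dec c | c <- codes]).
Proof. by rewrite mem_cat rootsE7_dec weights56_dec -mem_cat -map_cat. Qed.

Lemma dec_mem c : c \in codes -> dec c \in rootsE7 ++ weights56.
Proof. by move=> h; rewrite mem_X map_f. Qed.

(* Both directions go through opaque sigma types, so that conversion never evaluates
   the enumeration of the 182 vectors. *)
Lemma code_of (x : X) : {c | c \in codes & dec c = val x}.
Proof.
have /mapP : val x \in [seq dec c | c <- codes] by rewrite -mem_X (valP x).
by move=> /sig2_eqW[c hc e]; exists c.
Qed.

Lemma point_of (c : code) : {x : X | c \in codes -> val x = dec c}.
Proof.
have [h|h] := boolP (c \in codes); first by exists (SeqSub (dec_mem h)).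
by exists (SeqSub (dec_mem (mem_nth [::] (isT : 0 < size codes)%N))).
Qed.

Definition cd (x : X) : code := s2val (code_of x).
Definition pc (c : code) : X := sval (point_of c).

Lemma cd_mem x : cd x \in codes.
Proof. exact: (s2valP (code_of x)). Qed.

Lemma dec_cd x : dec (cd x) = val x.
Proof. exact: (s2valP' (code_of x)). Qed.

Lemma codes8 c : c \in codes -> size c = 8%N.
Proof. by move=> h; apply/eqP/(allP size_codes). Qed.

Lemma size_cd x : size (cd x) = 8%N.
Proof. exact/codes8/cd_mem. Qed.

Lemma val_pc c : c \in codes -> val (pc c) = dec c.
Proof. exact: (svalP (point_of c)). Qed.

Lemma pcK c : c \in codes -> cd (pc c) = c.
Proof.
move=> h; apply: (dec_injective (size_cd _) (codes8 h)).
by rewrite dec_cd val_pc.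
Qed.

Lemma cdK x : pc (cd x) = x.
Proof. by apply: val_inj; rewrite val_pc ?cd_mem // dec_cd. Qed.

Lemma roots_codes c : c \in root_codes -> c \in codes.
Proof. by move=> h; rewrite (mem_cat c root_codes) h. Qed.
Lemma weights_codes c : c \in weight_codes -> c \in codes.
Proof. by move=> h; rewrite (mem_cat c root_codes) h orbT. Qed.

Lemma val_root x : (val x \in rootsE7) = (cd x \in root_codes).
Proof.
rewrite rootsE7_dec -dec_cd; apply/mapP/idP => [[c hc e]|h]; last by exists (cd x).
by rewrite (dec_injective _ _ e) ?size_cd ?codes8 ?roots_codes.
Qed.

Lemma val_weight x : (x \in weightX) = (cd x \in weight_codes).
Proof.
rewrite inE weights56_dec -dec_cd; apply/mapP/idP => [[c hc e]|h]; last by exists (cd x).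
by rewrite (dec_injective _ _ e) ?size_cd ?codes8 ?weights_codes.
Qed.

(* Sixteen times the inner product. *)
Definition q (x y : X) : int := dot (cd x) (cd y).

Lemma ip_q x y : ip (val x) (val y) = (q x y)%:~R / 16%:R.
Proof. by rewrite -!dec_cd ip_dec ?size_cd. Qed.

Lemma eq_q x y x' y' : (q x y == q x' y') = (ip (val x) (val y) == ip (val x') (val y')).
Proof.
rewrite !ip_q; apply/eqP/eqP => [-> //|/(mulIf _) h].
by apply: (@intr_inj rat); apply: h.
Qed.

Lemma ipC u v : ip u v = ip v u.
Proof. by apply: eq_bigr => i _; rewrite mulrC. Qed.
Lemma ipDl u v w : ip (u + v) w = ip u w + ip v w.
Proof. by rewrite -big_split; apply: eq_bigr => i _; rewrite mxE mulrDl. Qed.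
Lemma ipZl a u w : ip (a *: u) w = a * ip u w.
Proof. by rewrite mulr_sumr; apply: eq_bigr => i _; rewrite mxE mulrA. Qed.
Lemma ipDr u v w : ip w (u + v) = ip w u + ip w v.
Proof. by rewrite ipC ipDl !(ipC w). Qed.
Lemma ipZr a u w : ip w (a *: u) = a * ip w u.
Proof. by rewrite ipC ipZl ipC. Qed.
Lemma ipNl u w : ip (- u) w = - ip u w.
Proof. by rewrite -scaleN1r ipZl mulN1r. Qed.
Lemma ipNr u w : ip w (- u) = - ip w u.
Proof. by rewrite ipC ipNl ipC. Qed.
Definition ipE := (ipDl, ipDr, ipZl, ipZr, ipNl, ipNr).

Lemma ip_eq0 u : ip u u = 0 -> u = 0.
Proof.
move=> /eqP; rewrite psumr_eq0 => [/allP h|i _]; last by rewrite -expr2 sqr_ge0.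
apply/rowP => k; rewrite mxE; apply/eqP.
by have := h k; rewrite mem_index_enum => /(_ isT) /=; rewrite mulf_eq0 orbb.
Qed.

Lemma qC x y : q x y = q y x.
Proof. by apply/eqP; rewrite eq_q ipC. Qed.

Definition ieq (a b : int) : bool :=
  match a, b with Posz m, Posz n => eqn m n | Negz m, Negz n => eqn m n | _, _ => false end.

Lemma ieqE a b : ieq a b = (a == b).
Proof. by case: a b => m [] n; rewrite /ieq ?eqnE. Qed.

(** [if] replaces [&&] because call-by-value evaluation would compute both arguments of [&&]. *)
Fixpoint ceq (c d : code) : bool :=
  match c, d with
  | a :: c', b :: d' => if ieq a b then ceq c' d' else false
  | [::], [::] => true | _, _ => false end.

Lemma ceqE c d : ceq c d = (c == d).
Proof.
elim: c d => [|a c IH] [|b d] //=; rewrite eqseq_cons ieqE IH.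
by case: (a == b).
Qed.

Definition cmem (c : code) (s : seq code) := has (ceq c) s.
Lemma cmemE c s : cmem c s = (c \in s).
Proof. by rewrite -has_pred1; apply: eq_has => d; rewrite ceqE /= eq_sym. Qed.

Lemma root_norm : all (fun c => ieq (dot c c) 32) root_codes.
Proof. by vm_compute. Qed.
Lemma weight_norm : all (fun c => ieq (dot c c) 24) weight_codes.
Proof. by vm_compute. Qed.

Lemma q_root x : val x \in rootsE7 -> q x x = 32.
Proof. by rewrite val_root => h; have /= := allP root_norm _ h; rewrite ieqE => /eqP. Qed.
Lemma q_weight x : x \in weightX -> q x x = 24.
Proof. by rewrite val_weight => h; have /= := allP weight_norm _ h; rewrite ieqE => /eqP. Qed.
Lemma root_or_weight x : (val x \in rootsE7) || (x \in weightX).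
Proof. by rewrite val_root val_weight -(mem_cat _ root_codes) cd_mem. Qed.
(** The norms 32/16 = 2 and 24/16 = 3/2 tell roots from weights, so every isometry of [X] preserves
    both kinds. *)
Lemma root_normE x : (val x \in rootsE7) = (q x x == 32).
Proof.
apply/idP/eqP => [/q_root //|h]; have /orP[//|/q_weight] := root_or_weight x.
by rewrite h.
Qed.
Lemma weight_normE x : (x \in weightX) = (q x x == 24).
Proof.
apply/idP/eqP => [/q_weight //|h]; have /orP[/q_root|//] := root_or_weight x.
by rewrite h.
Qed.

Fixpoint axpy (m : int) (b c : code) : code :=
  if c is a :: c' then if b is e :: b' then
    intZmod.addz a (intRing.mulz m e) :: axpy m b' c' else [::] else [::].

Lemma dec_axpy m b c : size b = 8%N -> size c = 8%N -> dec (axpy m b c) = dec c + m%:~R *: dec b.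
Proof.
case: b => [|b0 [|b1 [|b2 [|b3 [|b4 [|b5 [|b6 [|b7 [|? ?]]]]]]]]] // _.
case: c => [|c0 [|c1 [|c2 [|c3 [|c4 [|c5 [|c6 [|c7 [|? ?]]]]]]]]] // _.
apply/rowP => k; rewrite !mxE /=.
rewrite -![intZmod.addz _ _]/(@GRing.add int _ _) -![intRing.mulz _ _]/(@GRing.mul int _ _).
by case: k => [[|[|[|[|[|[|[|[|k]]]]]]]] hk] //=; rewrite rmorphD rmorphM /=; field.
Qed.

(* The quotient [- d / 16]; 0, 16 and 32 are, up to sign, the values [d] of [dot] between
   a root and another vector. *)
Definition coef (d : int) : int :=
  match d with Posz 16 => Negz 0 | Posz 32 => Negz 1 | Negz 15 => Posz 1 | Negz 31 => Posz 2 | _ => Posz 0 end.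

Definition rcode (b c : code) : code := axpy (coef (dot c b)) b c.

(** The first test confirms that the product is one of those listed in [coef]: on any other value
    the default 0 of [coef] fails it. *)
Definition refl_ok (s : seq code) (b c : code) : bool :=
  let d := dot c b in
  if ieq (intRing.mulz (coef d) (Posz 16)) (intZmod.oppz d) then cmem (axpy (coef d) b c) s
  else false.

Definition rcode_ok (s : seq code) : bool :=
  all (fun b => all (refl_ok s b) s) root_codes.

Lemma rcode_root : rcode_ok root_codes. Proof. by vm_compute. Qed.
Lemma rcode_weight : rcode_ok weight_codes. Proof. by vm_compute. Qed.

Lemma rcodeP b c : b \in root_codes -> c \in codes ->
  rcode b c \in codes /\ dec (rcode b c) = refl (dec b) (dec c).
Proof.
move=> hb hc; have [hd hm] : (coef (dot c b) * 16 = - dot c b) /\ (rcode b c \in codes).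
  move: (hc); rewrite (mem_cat c root_codes) => /orP[] h.
    have := allP (allP rcode_root _ hb) _ h; rewrite /refl_ok; case: ifP => //.
    by rewrite ieqE cmemE => /eqP e m; split=> //; apply: roots_codes.
  have := allP (allP rcode_weight _ hb) _ h; rewrite /refl_ok; case: ifP => //.
  by rewrite ieqE cmemE => /eqP e m; split=> //; apply: weights_codes.
have sb := codes8 (roots_codes hb); have sc := codes8 hc.
split=> //; rewrite dec_axpy // /refl !ip_dec //.
have := allP root_norm _ hb; rewrite /= ieqE => /eqP ->.
rewrite -scaleNr; congr (_ + _ *: _).
have -> : (dot c b)%:~R = - ((coef (dot c b))%:~R * 16%:R) :> rat.
  by rewrite -(rmorphM _ _ 16) /= hd rmorphN opprK.
by rewrite -[32%:~R]/(32%:R); field.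
Qed.

Opaque codes root_codes weight_codes.

(** * Reflections and isometries *)

Lemma ip_root b : b \in rootsE7 -> ip b b = 2%:R.
Proof.
rewrite rootsE7_dec => /mapP[c hc ->]; rewrite ip_dec ?codes8 ?roots_codes //.
by have := allP root_norm _ hc; rewrite /= ieqE => /eqP ->; rewrite -[32%:~R]/(32%:R); field.
Qed.

Lemma reflE b v : b \in rootsE7 -> refl b v = v - ip v b *: b.
Proof. by move=> hb; rewrite /refl ip_root //; congr (_ - _ *: _); field. Qed.

Lemma refl_ip b u v : b \in rootsE7 -> ip (refl b u) (refl b v) = ip u v.
Proof.
move=> hb; rewrite !reflE // !ipE (ip_root hb) (ipC b v); ring.
Qed.

Lemma refl_refl b v : b \in rootsE7 -> refl b (refl b v) = v.
Proof.
move=> hb; rewrite !reflE // !ipE ip_root // -addrA -opprD -scalerDl.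
rewrite -[RHS]subr0; congr (_ - _); rewrite -[RHS](scale0r b); congr (_ *: _); ring.
Qed.

Lemma reflpE b x : b \in rootsE7 -> val (reflp b x) = refl b (val x).
Proof.
move=> hb; have := hb; rewrite rootsE7_dec => /mapP[c hc eb].
pose f (y : X) := pc (rcode c (cd y)).
have fE y : val (f y) = refl b (val y).
  have [hm e] := rcodeP hc (cd_mem y).
  by rewrite val_pc // e dec_cd eb.
have fI : injective f.
  by move=> y z e; apply: val_inj; rewrite -(refl_refl (val y) hb) -fE e fE refl_refl.
rewrite /reflp; case: pickP => [g /forallP/(_ x)/eqP //|/(_ (perm fI))] /=.
by case/negP; apply/forallP => y; rewrite permE fE.
Qed.

Definition isometries : {set {perm X}} :=
  [set g : {perm X} | [forall x, forall y, q (g x) (g y) == q x y]].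

Lemma isometriesP (g : {perm X}) : reflect (forall x y, q (g x) (g y) = q x y) (g \in isometries).
Proof.
rewrite inE; apply: (iffP idP) => [/forallP h x y|h].
  by have /forallP/(_ y)/eqP := h x.
by apply/forallP => x; apply/forallP => y; rewrite h.
Qed.

Lemma group_set_isometries : group_set isometries.
Proof.
apply/group_setP; split; first by apply/isometriesP => x y; rewrite !perm1.
by move=> g h /isometriesP hg /isometriesP hh; apply/isometriesP => x y; rewrite !permM hh hg.
Qed.
Canonical isometries_group := Group group_set_isometries.

Lemma reflp_W b : b \in rootsE7 -> reflp b \in WE7.
Proof.
move=> hb; apply: mem_gen; apply/imsetP.
have hx : b \in rootsE7 ++ weights56 by rewrite mem_cat hb.
by exists (SeqSub hx).
Qed.

Lemma q_iso (g : {perm X}) x y : g \in WE7 -> q (g x) (g y) = q x y.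
Proof.
suff /subsetP h : WE7 \subset isometries by move=> /h /isometriesP.
rewrite gen_subG; apply/subsetP => _ /imsetP[b hb ->]; apply/isometriesP => u v.
by apply/eqP; rewrite eq_q !reflpE // refl_ip.
Qed.

Lemma ip_iso (g : {perm X}) x y : g \in WE7 -> ip (val (g x)) (val (g y)) = ip (val x) (val y).
Proof. by move=> h; rewrite !ip_q q_iso. Qed.

Lemma root_iso (g : {perm X}) x : g \in WE7 -> (val (g x) \in rootsE7) = (val x \in rootsE7).
Proof. by move=> h; rewrite !root_normE q_iso. Qed.

Lemma weight_iso (g : {perm X}) x : g \in WE7 -> (g x \in weightX) = (x \in weightX).
Proof. by move=> h; rewrite !weight_normE q_iso. Qed.

Lemma ip_sub_lin (a c : rat) u v w :
  ip (w - (a *: u + c *: v)) (w - (a *: u + c *: v)) =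
  ip w w + a * a * ip u u + c * c * ip v v
  - 2%:R * a * ip w u - 2%:R * c * ip w v + 2%:R * a * c * ip u v.
Proof.
rewrite ipDl !ipDr !ipNl !ipNr !ipDl !ipDr !ipZl !ipZr.
by rewrite (ipC u w) (ipC v w) (ipC v u); ring.
Qed.

(** Elements of [WE7] are permutations of [X], with no linear extension at hand. A linear relation
    among three vectors survives because the norm of the difference of its two sides is an
    expression in inner products, hence remains 0. *)
Lemma lin_iso (g : {perm X}) a x c y z : g \in WE7 ->
  val z = a *: val x + c *: val y -> val (g z) = a *: val (g x) + c *: val (g y).
Proof.
move=> hg e; apply/eqP; rewrite -subr_eq0; apply/eqP/ip_eq0.
rewrite ip_sub_lin !(ip_iso _ _ hg) -ip_sub_lin e subrr.
by rewrite -(scale0r 0) ipZl mul0r.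
Qed.

Definition ncode (c : code) : code := [seq intZmod.oppz a | a <- c].

Lemma ncode_ok : all (fun c => cmem (ncode c) codes) codes.
Proof. by vm_compute. Qed.

Definition neg (x : X) : X := pc (ncode (cd x)).

Lemma val_neg x : val (neg x) = - val x.
Proof.
rewrite /neg val_pc; last by have := allP ncode_ok _ (cd_mem x); rewrite cmemE.
rewrite -(dec_cd x); apply/rowP => k; rewrite !mxE (nth_map 0) ?size_cd //.
by rewrite -mulNr -rmorphN.
Qed.

Lemma negK : involutive neg.
Proof. by move=> x; apply: val_inj; rewrite !val_neg opprK. Qed.

Lemma q_negl x y : q (neg x) y = - q x y.
Proof.
have := ip_q (neg x) y; rewrite val_neg ipNl ip_q -mulNr -rmorphN /= => /(mulIf _) h.
by apply: (@intr_inj rat); rewrite h.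
Qed.
Lemma q_negr x y : q x (neg y) = - q x y.
Proof. by rewrite qC q_negl qC. Qed.

Lemma neg_iso (g : {perm X}) x : g \in WE7 -> g (neg x) = neg (g x).
Proof.
move=> hg; apply: val_inj; rewrite val_neg.
have := @lin_iso g (-1) x 0 x (neg x) hg; rewrite !scale0r !addr0 !scaleN1r.
by apply; rewrite val_neg.
Qed.

Lemma neg_weight x : (neg x \in weightX) = (x \in weightX).
Proof. by rewrite !weight_normE q_negl q_negr opprK. Qed.

Lemma reflp_conj (g : {perm X}) b : g \in WE7 -> val b \in rootsE7 ->
  (reflp (val b) ^ g)%g = reflp (val (g b)).
Proof.
move=> hg hb; apply/permP => y; rewrite -(permKV g y) permJ.
set x := (g^-1)%g y; apply: val_inj.
have hgb : val (g b) \in rootsE7 by rewrite root_iso.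
rewrite reflpE // reflE // ip_iso //.
have /(lin_iso hg) -> : val (reflp (val b) x) = 1 *: val x + (- ip (val x) (val b)) *: val b.
  by rewrite reflpE // reflE // scale1r scaleNr.
by rewrite scale1r scaleNr.
Qed.

(** A finite substitute for [D] spanning the space, decided by computation; with it, an element of W
    that fixes [D] is trivial. *)
Definition separates (D : seq code) : bool :=
  uniq [seq [seq dot c d | d <- D] | c <- codes].

Lemma uniq_map_inj (T1 T2 : eqType) (f : T1 -> T2) (s : seq T1) :
  uniq (map f s) -> {in s &, injective f}.
Proof.
elim: s => //= a s IH /andP[na us] x y; rewrite !inE.
case/orP => [/eqP->|xs]; case/orP => [/eqP->|ys] // e.
- by move: na; rewrite e map_f.
- by move: na; rewrite -e map_f.
- exact: IH.
Qed.

Lemma separatesP D x y : separates D -> {subset D <= codes} ->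
  (forall d, d \in D -> q x (pc d) = q y (pc d)) -> x = y.
Proof.
move=> u sD h; apply: (can_inj cdK).
apply: (@uniq_map_inj _ _ (fun c => [seq dot c d | d <- D]) codes u); rewrite ?cd_mem //.
by apply/eq_in_map => d hd; have := h d hd; rewrite /q pcK ?sD.
Qed.

Lemma fix_separates D (g : {perm X}) : separates D -> {subset D <= codes} -> g \in WE7 ->
  (forall d, d \in D -> g (pc d) = pc d) -> g = 1%g.
Proof.
move=> u sD hg h; apply/permP => x; rewrite perm1.
by apply: (separatesP u sD) => d hd; rewrite -{1}(h d hd) q_iso.
Qed.

Definition wt (i j : nat) : code :=
  two_val (Posz 3) (Negz 0) (mkseq (fun k => (k == i) || (k == j)) 8).

#[global] Arguments wt : simpl never.

Definition weight_basis : seq code := [seq wt 0 i | i <- iota 1 7].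
Lemma separates_weight_basis : separates weight_basis.
Proof. by vm_compute. Qed.
Lemma weight_basis_mem : all (fun c => cmem c weight_codes) weight_basis.
Proof. by vm_compute. Qed.

Lemma fix_weights (g : {perm X}) : g \in WE7 -> (forall x, x \in weightX -> g x = x) -> g = 1%g.
Proof.
have sw c : c \in weight_basis -> c \in weight_codes.
  by move=> h; have := allP weight_basis_mem _ h; rewrite cmemE.
move=> hg h; apply: (fix_separates separates_weight_basis) => // d /sw hd.
  exact: weights_codes.
by apply: h; rewrite val_weight pcK // weights_codes.
Qed.

Definition diff_ok (c d : code) : bool :=
  if ieq (dot c d) (Posz 8) then cmem (axpy (Negz 0) d c) root_codes else true.
Lemma diff_root : all (fun c => all (diff_ok c) weight_codes) weight_codes.
Proof. by vm_compute. Qed.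

(** The difference of the two weights is a root, and [s] is its reflection. The last clause holds
    since equal products with [x] and [y] mean orthogonality to that root; it lets a chain of such
    swaps fix a prescribed set of vectors. *)
Lemma weight_swap x y : x \in weightX -> y \in weightX -> q x y = 8 ->
  exists s : {perm X}, [/\ s \in WE7, s x = y & forall z, q z x = q z y -> s z = z].
Proof.
move=> hx hy e; have hb : val x - val y \in rootsE7.
  move: (hx) (hy); rewrite !val_weight => cx cy.
  have := allP (allP diff_root _ cx) _ cy; rewrite /diff_ok -/(q x y) e /= cmemE => h.
  rewrite -!dec_cd -scaleN1r -(dec_axpy (-1)) ?size_cd // rootsE7_dec map_f //.
have [nx ny] : ip (val x) (val x) = 3%:R / 2%:R /\ ip (val x) (val y) = 1 / 2%:R.
  by rewrite !ip_q q_weight // e -[24%:~R]/(24%:R) -[8%:~R]/(8%:R); split; field.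
exists (reflp (val x - val y)); split; first exact: reflp_W.
  apply: val_inj; rewrite reflpE // reflE // !ipE nx ny.
  rewrite [X in X *: _](_ : _ = 1); last by field.
  by rewrite scale1r opprB addrC subrK.
move=> z /eqP; rewrite eq_q => /eqP ez; apply: val_inj; rewrite reflpE // reflE // !ipE ez.
by rewrite subrr scale0r subr0.
Qed.

Definition candidate (D : seq (code * int)) (c : code) : bool :=
  all (fun p => ieq (dot c p.1) p.2) D.

(* Unlike [has], stops at the first hit also under call-by-value evaluation. *)
Fixpoint lazy_has (T : Type) (p : pred T) (s : seq T) : bool :=
  if s is x :: s' then if p x then true else lazy_has p s' else false.

Lemma lazy_hasE (T : Type) (p : pred T) s : lazy_has p s = has p s.
Proof. by elim: s => //= x s ->; case: (p x). Qed.

Fixpoint reach (s : seq code) (y : code) (n : nat) (c : code) : bool :=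
  if ceq c y then true else
  if n is n'.+1 then lazy_has (fun u => if ieq (dot c u) (Posz 8) then reach s y n' u else false) s
  else false.

Definition connected_to (D : seq (code * int)) (y : code) : bool :=
  let s := filter (candidate D) weight_codes in all (reach s y 3) s.

(** All weights on a path inside the candidates have the same products with [D], so the reflections
    along the path fix [D]. Connectedness of the graph of candidates thus yields transitivity of the
    stabiliser of [D] on them. *)
Lemma connected_toP D y x : connected_to D y -> {subset unzip1 D <= codes} ->
  x \in weightX -> (forall p, p \in D -> q x (pc p.1) = p.2) ->
  exists w : {perm X}, [/\ w \in WE7, w x = pc y & forall p, p \in D -> w (pc p.1) = pc p.1].
Proof.
rewrite /connected_to; set s := filter _ _ => con sD hx hD.
have inD p : p \in D -> p.1 \in codes by move=> h; apply/sD/map_f.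
have cand z : z \in weightX -> (cd z \in s) = [forall p : seq_sub D, q z (pc (val p).1) == (val p).2].
  rewrite val_weight mem_filter => ->; rewrite andbT; apply/allP/forallP => [h p|h p hp].
    by have := h _ (valP p); rewrite ieqE /q pcK // inD // (valP p).
  by have := h (SeqSub hp); rewrite ieqE /q pcK // inD.
have xs : cd x \in s by rewrite cand //; apply/forallP => p; rewrite hD // (valP p).
have {con} := allP con _ xs; move: 3%N => n.
have base z : cd z = y ->
  exists w : {perm X}, [/\ w \in WE7, w z = pc y & forall p, p \in D -> w (pc p.1) = pc p.1].
  by move=> <-; exists 1%g; split; rewrite ?group1 ?perm1 ?cdK // => p _; rewrite perm1.
elim: n x hx {hD} xs => [|n IH] x hx xs; rewrite [reach _ _ _ _]/= ceqE ?lazy_hasE.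
  by case: eqP => [/base|].
case: eqP => [/base //|_].
case/hasP => u us; case: ifP => //; rewrite ieqE => /eqP e8 ru.
have uw : u \in weight_codes by move: us; rewrite mem_filter => /andP[].
have uc := weights_codes uw.
have hu : pc u \in weightX by rewrite val_weight pcK.
have us' : cd (pc u) \in s by rewrite pcK.
have [w [hw wu wD]] := IH (pc u) hu us' (eq_ind_r (reach s y n) ru (pcK uc)).
have qxu : q x (pc u) = 8 by rewrite /q pcK.
have [t [ht tx tD]] := weight_swap hx hu qxu.
exists (t * w)%g; split; rewrite ?groupM ?permM ?tx // => p hp.
rewrite permM tD ?wD //; have := us'; have := xs; rewrite !cand // => /forallP/(_ (SeqSub hp))/eqP h1 /forallP/(_ (SeqSub hp))/eqP h2.
by rewrite qC h1 qC h2.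
Qed.

(** * Abelian groups fixing three weights *)

Lemma uniq_weight_codes : uniq weight_codes.
Proof. by vm_compute. Qed.
Lemma size_weight_codes : size weight_codes = 56%N.
Proof. by vm_compute. Qed.

Lemma card_weights (P : pred code) :
  #|[set x in weightX | P (cd x)]| = count P weight_codes.
Proof.
rewrite -size_filter -(size_map pc) cardE; apply/perm_size/uniq_perm.
- exact: enum_uniq.
- rewrite map_inj_in_uniq ?filter_uniq ?uniq_weight_codes // => c d.
  rewrite !mem_filter => /andP[_ /weights_codes hc] /andP[_ /weights_codes hd] e.
  by rewrite -(pcK hc) -(pcK hd) e.
move=> x; rewrite mem_enum inE val_weight; apply/andP/mapP => [[xw Px]|[c]].
  by exists (cd x); rewrite ?cdK // mem_filter Px.
by rewrite mem_filter => /andP[Pc hc] ->; rewrite pcK ?weights_codes.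
Qed.

Lemma card_weightX : #|weightX| = 56%N.
Proof.
rewrite -size_weight_codes -[RHS](count_predT weight_codes) -(card_weights predT).
by apply: eq_card => x; rewrite inE andbT.
Qed.

Definition weight_pair_ok (c d : code) : bool :=
  let e := dot c d in
  if ieq e (Posz 8) then true else if ieq e (Negz 7) then true
  else if ceq c d then true else ceq c (ncode d).
Lemma weight_pairs : all (fun c => all (weight_pair_ok c) weight_codes) weight_codes.
Proof. by vm_compute. Qed.

Lemma q_weights x y : x \in weightX -> y \in weightX -> x != y -> x != neg y ->
  q x y = 8 \/ q x y = -8.
Proof.
rewrite !val_weight => cx cy nxy nxn.
have := allP (allP weight_pairs _ cx) _ cy; rewrite /weight_pair_ok !ieqE.
rewrite !ceqE /q; case: eqP => [->|_]; first by left.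
case: eqP => [->|_]; first by right.
case: eqP => [e|_]; first by rewrite -(cdK x) e cdK eqxx in nxy.
by move=> /eqP e; rewrite -(cdK x) e eqxx in nxn.
Qed.

Definition fixed_weights (B : {set {perm X}}) : {set X} := ('Fix_(weightX | 'P)(B))%g.

Lemma fixed_weightsP (B : {set {perm X}}) x :
  reflect (x \in weightX /\ forall b, b \in B -> b x = x) (x \in fixed_weights B).
Proof.
apply: (iffP setIP) => [] [h]; first by move/afixP.
by move=> h'; split=> //; apply/afixP.
Qed.

Lemma fixed_weights_neg (B : {set {perm X}}) x : B \subset WE7 ->
  (neg x \in fixed_weights B) = (x \in fixed_weights B).
Proof.
move=> sB; apply/fixed_weightsP/fixed_weightsP; rewrite neg_weight => -[h hb]; split=> // b bB.
  by apply: (can_inj negK); rewrite -neg_iso ?hb // (subsetP sB).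
by rewrite neg_iso ?hb // (subsetP sB).
Qed.

Lemma fixed_weights_conj (B : {set {perm X}}) w x : w \in WE7 ->
  x \in fixed_weights B -> w x \in fixed_weights (B :^ w)%g.
Proof.
move=> hw /fixed_weightsP[xw hb]; apply/fixed_weightsP; rewrite weight_iso //; split=> //.
by move=> _ /imsetP[b bB ->]; rewrite permJ hb.
Qed.

Lemma card_fixed_weights_conj (B : {set {perm X}}) w : w \in WE7 ->
  (#|fixed_weights B| <= #|fixed_weights (B :^ w)%g|)%N.
Proof.
move=> hw; rewrite -(card_imset _ (@perm_inj _ w)); apply: subset_leq_card.
by apply/subsetP => _ /imsetP[x xB ->]; apply: fixed_weights_conj.
Qed.

(* [T] is a set of weights cut out by inner products with fixed weights, hence stable;
   together with those weights it separates points. *)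
Lemma abelian_bound (B : {group {perm X}}) (D : seq (code * int)) :
  let T := [seq c <- weight_codes | candidate D c] in
  B \subset WE7 -> abelian B -> {subset unzip1 D <= codes} ->
  (forall c, c \in unzip1 D -> pc c \in fixed_weights B) ->
  separates (unzip1 D ++ T) -> (#|B| ^ 3 <= 3 ^ size T)%N.
Proof.
move=> T sB abB sD fD sep.
have sT : {subset T <= codes} by move=> c; rewrite mem_filter => /andP[_ /weights_codes].
pose S := [set x in weightX | candidate D (cd x)].
have -> : size T = #|S| by rewrite card_weights size_filter.
have actS : [acts B, on S | 'P].
  apply/subsetP => b bB; rewrite !inE; apply/subsetP => x; rewrite !inE /= apermE.
  have hb := subsetP sB _ bB.
  have := weight_iso x hb; rewrite !inE => -> /andP[-> /allP h] /=; apply/allP => p pD.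
  have hp : p.1 \in unzip1 D by apply: map_f.
  have /fixed_weightsP[_ /(_ _ bB) e] := fD _ hp.
  have := h p pD; rewrite -(pcK (sD _ hp)) -!/(q _ _).
  by rewrite -{2}e q_iso.
have := abelian_index_cube abB actS.
suff -> : 'C_B(S | 'P)%g = 1%g by rewrite indexg1.
apply/trivgP/subsetP => b /setIP[bB /astabP cb]; rewrite inE; apply/eqP.
apply: (fix_separates sep); first by move=> c; rewrite mem_cat => /orP[/sD|/sT].
  exact: (subsetP sB).
move=> c; rewrite mem_cat => /orP[/fD /fixed_weightsP[_ /(_ _ bB)] //|cT].
rewrite -[LHS]/('P%act (pc c) b) cb // inE val_weight pcK ?sT //.
by move: cT; rewrite mem_filter => /andP[-> ->].
Qed.

(* The triples of weights with all inner products 1/2, respectively all -1/2 up to signs,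
   extended by the inner products defining the set [T] of [abelian_bound]. *)
Definition pos_base := [:: (wt 0 1, Posz 8); (wt 0 2, Posz 8); (wt 1 2, Negz 7)].
Definition neg_base := [:: (wt 0 1, Posz 8); (wt 0 2, Negz 7); (wt 2 3, Negz 7)].
Definition pos_tail : seq code := [seq wt 0 i | i <- iota 3 5].

Lemma pos_tailE : [seq c <- weight_codes | candidate pos_base c] = pos_tail.
Proof. by apply/eqP; vm_compute. Qed.
Lemma size_neg_tail : size [seq c <- weight_codes | candidate neg_base c] = 8%N.
Proof. by vm_compute. Qed.
Lemma pos_separates : separates (unzip1 pos_base ++ pos_tail).
Proof. by vm_compute. Qed.
Lemma neg_separates :
  separates (unzip1 neg_base ++ [seq c <- weight_codes | candidate neg_base c]).
Proof. by vm_compute. Qed.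
Lemma base_weights : all (fun c => cmem c weight_codes)
  (unzip1 pos_base ++ unzip1 neg_base ++ pos_tail).
Proof. by vm_compute. Qed.

Definition agree (s : seq nat) (r : seq int) : bool :=
  all (fun k => ieq (nth (Posz 0) r k) (nth (Posz 0) r (nth 0%N s k))) (iota 0 5).
Definition tail_row (c : code) : seq int := [seq dot c t | t <- pos_tail].

Fixpoint count2 (m m' : bitseq) : nat :=
  match m, m' with
  | b :: s, b' :: s' => if b then (if b' then (count2 s s').+1 else count2 s s') else count2 s s'
  | _, _ => 0%N end.

Lemma count2_map (T : Type) (f g : pred T) (s : seq T) :
  count2 (map f s) (map g s) = count (predI f g) s.
Proof. by elim: s => //= c s ->; case: (f c) (g c) => [] []. Qed.

Definition masks : seq (seq nat * bitseq) :=
  let rows := map tail_row weight_codes in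
  [seq (s, map (agree s) rows) | s <- permutations (iota 0 5)].

(** A single element would not do: a reflection fixes 32 of the 56 weights, and 6 * 32 exceeds 128.
    Two distinct nontrivial permutations bring the number down to 20, and 6 * 20 is below 128. *)
Definition few_common_fixed : bool :=
  let ms := [seq m <- masks | m.1 != iota 0 5] in
  all (fun m => all (fun m' => if m.1 == m'.1 then true else (count2 m.2 m'.2 <= 20)%N) ms) ms.

Lemma few_common_fixedT : few_common_fixed.
Proof. by vm_compute. Qed.

Lemma few_common_fixedP s t : s \in permutations (iota 0 5) -> t \in permutations (iota 0 5) ->
  s != iota 0 5 -> t != iota 0 5 -> s != t ->
  (count (fun c => agree s (tail_row c) && agree t (tail_row c)) weight_codes <= 20)%N.
Proof.
have key u : u \in permutations (iota 0 5) -> u != iota 0 5 ->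
    (u, map (agree u) (map tail_row weight_codes)) \in [seq m <- masks | m.1 != iota 0 5].
  by move=> hu nu; rewrite mem_filter nu /=; apply/mapP; exists u.
move=> hs ht ns nt nst; have := allP (allP few_common_fixedT _ (key s hs ns)) _ (key t ht nt).
rewrite [(_, _).1]/= [(_, _).1]/= (negPf nst) [(_, _).2]/= [(_, _).2]/=.
by rewrite -!map_comp count2_map.
Qed.

Lemma base_weight c : c \in unzip1 pos_base ++ unzip1 neg_base ++ pos_tail -> c \in weight_codes.
Proof. by move=> h; have := allP base_weights _ h; rewrite cmemE. Qed.

Lemma cube_le_inv (n m k : nat) : (n ^ 3 <= m)%N -> (m < k.+1 ^ 3)%N -> (n <= k)%N.
Proof.
by move=> h1 h2; rewrite -ltnS -(@ltn_exp2r n k.+1 3) //; apply: leq_ltn_trans h1 h2.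
Qed.

(* An element fixing the base permutes the five weights of [pos_tail]; its fixed weights are
   among those whose inner products with [pos_tail] are invariant under this permutation. *)
Lemma pos_tail_perm (b : {perm X}) : b \in WE7 ->
  (forall c, c \in unzip1 pos_base -> b (pc c) = pc c) ->
  exists2 s, s \in permutations (iota 0 5) &
    forall k, (k < 5)%N -> b (pc (nth [::] pos_tail k)) = pc (nth [::] pos_tail (nth 0%N s k)).
Proof.
move=> hb fb.
have tw c : c \in pos_tail -> c \in weight_codes.
  by move=> h; apply: base_weight; rewrite !mem_cat h !orbT.
have im c : c \in pos_tail -> cd (b (pc c)) \in pos_tail.
  move=> h; have := h; rewrite -!pos_tailE !mem_filter => /andP[/allP hc hw].
  rewrite -val_weight weight_iso // val_weight pcK ?weights_codes // hw andbT.
  apply/allP => p hp; have hp1 : p.1 \in unzip1 pos_base by apply: map_f.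
  have pw : p.1 \in weight_codes by apply: base_weight; rewrite mem_cat hp1.
  have := hc p hp; rewrite -{2}(pcK (weights_codes pw)) -/(q _ _) -(fb _ hp1) q_iso //.
  by rewrite /q !pcK ?weights_codes.
pose s := [seq index (cd (b (pc c))) pos_tail | c <- pos_tail].
have ss k : (k < 5)%N -> nth 0%N s k = index (cd (b (pc (nth [::] pos_tail k)))) pos_tail.
  by move=> lk; rewrite (nth_map [::]).
exists s; last first.
  move=> k lk; rewrite ss // nth_index ?im ?cdK //; exact: mem_nth.
have us : uniq s.
  rewrite map_inj_in_uniq; first by vm_compute.
  move=> c d hc hd e.
  have := nth_index [::] (im _ hc); rewrite e nth_index ?im // => /(can_inj cdK)/perm_inj e'.
  by rewrite -(pcK (weights_codes (tw _ hc))) -e' pcK // weights_codes // tw.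
have sub : {subset s <= iota 0 5}.
  by move=> k /mapP[c hc ->]; rewrite mem_iota; have := im c hc; rewrite -index_mem.
rewrite mem_permutations; apply: uniq_perm; rewrite ?iota_uniq //.
by apply: (uniq_min_size us sub _).2; rewrite size_map.
Qed.

Lemma standard_pos (B : {group {perm X}}) : B \subset WE7 -> abelian B ->
  (forall c, c \in unzip1 pos_base -> pc c \in fixed_weights B) ->
  (#|B| <= 6)%N /\ ((2 < #|B|)%N -> (#|fixed_weights B| <= 20)%N).
Proof.
move=> sB abB fB.
have bw c : c \in unzip1 pos_base -> c \in weight_codes.
  by move=> h; apply: base_weight; rewrite mem_cat h.
have fb b c : b \in B -> c \in unzip1 pos_base -> b (pc c) = pc c.
  by move=> bB /fB/fixed_weightsP[_ ->].
have := abelian_bound sB abB (fun c h => weights_codes (bw c h)) fB.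
rewrite pos_tailE => /(_ pos_separates) b3.
(* 3^5 = 243 is below 7^3 = 343. *)
split; first by apply: cube_le_inv b3 _.
have tw c : c \in pos_tail -> c \in weight_codes.
  by move=> h; apply: base_weight; rewrite !mem_cat h !orbT.
have eq_tail b b' : b \in B -> b' \in B ->
    (forall k, (k < 5)%N -> b (pc (nth [::] pos_tail k)) = b' (pc (nth [::] pos_tail k))) -> b = b'.
  move=> bB b'B h; apply/eqP; rewrite eq_mulgV1; apply/eqP.
  apply: (fix_separates pos_separates); rewrite ?groupM ?groupV ?(subsetP sB) //.
    by move=> c; rewrite mem_cat => /orP[/bw|/tw] /weights_codes.
  move=> c; rewrite mem_cat permM => /orP[hc|hc].
    by rewrite (fb b) // -[in LHS](fb b' c) // permK.
  by rewrite -(nth_index [::] hc) h ?permK // -[5%N]/(size pos_tail) index_mem.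
(* A group of order above 2 has two distinct nontrivial elements; by [eq_tail] they induce distinct
   nontrivial permutations of [pos_tail]. *)
rewrite (cardsD1 1%g) group1 ltnS => B1.
have /card_gt1P[b1 [b2 [/setD1P[n1 b1B] /setD1P[n2 b2B] n12]]] : (1 < #|B :\ 1%g|)%N by [].
have [s hs sE] := pos_tail_perm (subsetP sB _ b1B) (fun c => fb b1 c b1B).
have [t ht tE] := pos_tail_perm (subsetP sB _ b2B) (fun c => fb b2 c b2B).
have ns : s != iota 0 5.
  apply: contra n1 => /eqP e; apply/eqP/(eq_tail _ _ b1B (group1 B)) => k lk.
  by rewrite perm1 sE // e (nth_iota _ _ lk).
have nt : t != iota 0 5.
  apply: contra n2 => /eqP e; apply/eqP/(eq_tail _ _ b2B (group1 B)) => k lk.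
  by rewrite perm1 tE // e (nth_iota _ _ lk).
have nst : s != t.
  by apply: contra n12 => /eqP e; apply/eqP/(eq_tail _ _ b1B b2B) => k lk; rewrite sE ?tE ?e.
apply: leq_trans (few_common_fixedP hs ht ns nt nst); rewrite -card_weights.
have agr b u x : b \in B -> b x = x -> u \in permutations (iota 0 5) ->
    (forall k, (k < 5)%N -> b (pc (nth [::] pos_tail k)) = pc (nth [::] pos_tail (nth 0%N u k))) ->
    agree u (tail_row (cd x)).
  move=> bB bx hu uE; apply/allP => k; rewrite mem_iota /= add0n => lk.
  have lu : (nth 0%N u k < 5)%N.
    have su : size u = 5%N by move: hu; rewrite mem_permutations => /perm_size.
    have : nth 0%N u k \in iota 0 5.
      by move: hu; rewrite mem_permutations => /perm_mem <-; rewrite mem_nth // su.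
    by rewrite mem_iota.
  rewrite ieqE /tail_row !(nth_map [::]) //.
  have tc j : (j < 5)%N -> nth [::] pos_tail j \in codes.
    by move=> lj; apply/weights_codes/tw/mem_nth.
  rewrite -{1}(pcK (tc k lk)) -{1}(pcK (tc _ lu)) -!/(q _ _) -uE //.
  by rewrite -{2}bx q_iso // (subsetP sB).
apply: subset_leq_card; apply/subsetP => x /fixed_weightsP[xw fx]; rewrite inE xw /=.
by rewrite (agr b1) ?fx // (agr b2) ?fx.
Qed.

(* Among [c] and the signed weights of the negative triple there are three weights with
   all inner products 1/2. *)
Definition triple_of (c : code) : bool :=
  let s := [:: wt 0 1; wt 0 2; wt 2 3] in
  let s := s ++ map ncode s in
  has (fun a => if ieq (dot c a) (Posz 8) then
    has (fun b => if ieq (dot a b) (Posz 8) then ieq (dot c b) (Posz 8) else false) s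
    else false) s.

Lemma few_without_triple : (count (predC triple_of) weight_codes <= 8)%N.
Proof. by vm_compute. Qed.

Lemma ncode_pc c : c \in codes -> pc (ncode c) = neg (pc c).
Proof. by move=> h; rewrite /neg pcK. Qed.

(** All but at most eight weights complete two signed base weights to a positive triple. So either
    [B] fixes at most eight weights, or the sharper bounds of the positive case become available. *)
Lemma standard_neg (B : {group {perm X}}) : B \subset WE7 -> abelian B ->
  (forall c, c \in unzip1 neg_base -> pc c \in fixed_weights B) ->
  (#|B| <= 18)%N /\ ((8 < #|fixed_weights B|)%N -> exists x y z,
    [/\ x \in fixed_weights B, y \in fixed_weights B & z \in fixed_weights B] /\
    [/\ q x y = 8, q y z = 8 & q x z = 8]).
Proof.
move=> sB abB fB.
have bw c : c \in unzip1 neg_base -> c \in weight_codes.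
  by move=> h; apply: base_weight; rewrite !mem_cat h !orbT.
have := abelian_bound sB abB (fun c h => weights_codes (bw c h)) fB.
move=> /(_ neg_separates); rewrite size_neg_tail => b3.
(* 3^8 = 6561 is below 19^3 = 6859. *)
split; first by apply: cube_le_inv b3 _.
move=> f8; have [x xB tx] : exists2 x, x \in fixed_weights B & triple_of (cd x).
  apply/exists_inP; apply: contraLR f8 => /exists_inPn h; rewrite -leqNgt.
  apply: leq_trans few_without_triple; rewrite -card_weights.
  apply: subset_leq_card; apply/subsetP => x xB; rewrite inE /= h // andbT.
  by case/fixed_weightsP: xB.
set s := unzip1 neg_base; have sf a : a \in s ++ map ncode s -> pc a \in fixed_weights B /\ cd (pc a) = a.
  rewrite mem_cat => /orP[hs|/mapP[c hs ->]].
    by split; [apply: fB|rewrite pcK // weights_codes // bw].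
  have hc := weights_codes (bw c hs).
  have nc : ncode c \in codes by have := allP ncode_ok _ hc; rewrite cmemE.
  by rewrite pcK // ncode_pc // fixed_weights_neg //; split=> //; apply: fB.
case/hasP: tx => a /sf[fa ca]; case: ifP => //; rewrite ieqE => /eqP xa.
case/hasP => b /sf[fb cb]; case: ifP => //; rewrite ieqE => /eqP ab; rewrite ieqE => /eqP xb.
by exists x, (pc a), (pc b); rewrite /q ca cb.
Qed.

Lemma connected_1 : connected_to [::] (wt 0 1). Proof. by vm_compute. Qed.
Lemma connected_2 : connected_to [:: (wt 0 1, Posz 8)] (wt 0 2). Proof. by vm_compute. Qed.
Lemma connected_pos : connected_to [:: (wt 0 1, Posz 8); (wt 0 2, Posz 8)] (wt 1 2).
Proof. by vm_compute. Qed.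
Lemma connected_neg : connected_to [:: (wt 0 1, Negz 7); (wt 0 2, Posz 8)] (wt 2 3).
Proof. by vm_compute. Qed.

Lemma wt_weights : all (fun c => cmem c weight_codes) [:: wt 0 1; wt 0 2; wt 1 2; wt 2 3].
Proof. by vm_compute. Qed.

Lemma wt_codes : {subset [:: wt 0 1; wt 0 2; wt 1 2; wt 2 3] <= codes}.
Proof. by move=> c hc; apply: weights_codes; have := allP wt_weights _ hc; rewrite cmemE. Qed.

(** The weights are moved into place one at a time, each by reflections that fix those already
    placed. *)
Lemma triple_standard x y z (e : bool) :
  x \in weightX -> y \in weightX -> z \in weightX ->
  q x y = 8 -> q y z = 8 -> q x z = (if e then 8 else -8) ->
  exists2 w, w \in WE7 & [/\ w x = pc (wt 0 1), w y = pc (wt 0 2)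
                             & w z = pc (if e then wt 1 2 else wt 2 3)].
Proof.
move=> hx hy hz xy yz xz.
have [|//|w1 [h1 w1x _]] := connected_toP connected_1 _ hx; first by [].
have sub2 : {subset unzip1 [:: (wt 0 1, Posz 8)] <= codes}.
  by move=> c hc; apply: wt_codes; move: hc; rewrite [unzip1 _]/= !in_cons in_nil orbF => ->.
have hy1 : w1 y \in weightX by rewrite weight_iso.
have [|w2 [h2 w2y w2D]] := connected_toP connected_2 sub2 hy1.
  by move=> p; rewrite inE => /eqP -> /=; rewrite -w1x q_iso // qC.
have w2x : w2 (pc (wt 0 1)) = pc (wt 0 1) by apply: (w2D (_, _)); rewrite inE.
have hz2 : w2 (w1 z) \in weightX by rewrite !weight_iso.
have z1 : q (w2 (w1 z)) (pc (wt 0 1)) = if e then 8 else -8.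
  by rewrite -w2x q_iso // -w1x q_iso // qC.
have z2 : q (w2 (w1 z)) (pc (wt 0 2)) = 8 by rewrite -w2y !q_iso // qC.
have sub3 (a b : int) : {subset unzip1 [:: (wt 0 1, a); (wt 0 2, b)] <= codes}.
  move=> c hc; apply: wt_codes; move: hc; rewrite [unzip1 _]/= !in_cons in_nil orbF.
  by case/orP=> ->; rewrite ?orbT.
have [w3 [h3 w3z w3x w3y]] : exists w3 : {perm X}, [/\ w3 \in WE7,
    w3 (w2 (w1 z)) = pc (if e then wt 1 2 else wt 2 3),
    w3 (pc (wt 0 1)) = pc (wt 0 1) & w3 (pc (wt 0 2)) = pc (wt 0 2)].
  case: e z1 {xz} => z1.
    have [|w3 [h3 w3z w3D]] := connected_toP connected_pos (sub3 _ _) hz2.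
      by move=> p; rewrite !inE => /orP[/eqP->|/eqP->]; rewrite /= ?z1 ?z2.
    exists w3; split=> //; first exact: (w3D (wt 0 1, _) (mem_head _ _)).
    exact: (w3D (wt 0 2, _) (mem_last (wt 0 1, _) [:: _])).
  have [|w3 [h3 w3z w3D]] := connected_toP connected_neg (sub3 _ _) hz2.
    by move=> p; rewrite !inE => /orP[/eqP->|/eqP->]; rewrite /= ?z1 ?z2.
  exists w3; split=> //; first exact: (w3D (wt 0 1, _) (mem_head _ _)).
  exact: (w3D (wt 0 2, _) (mem_last (wt 0 1, _) [:: _])).
exists (w1 * w2 * w3)%g; first by rewrite !groupM.
by rewrite !permM w1x w2x w3x w2y w3y w3z.
Qed.

Section FixedTriple.
Variable B : {group {perm X}}.
Hypotheses (sB : B \subset WE7) (abB : abelian B).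
Let F := fixed_weights B.

Lemma fixed_pos x y z : x \in F -> y \in F -> z \in F ->
  q x y = 8 -> q y z = 8 -> q x z = 8 ->
  (#|B| <= 6)%N /\ ((2 < #|B|)%N -> (#|F| <= 20)%N).
Proof.
move=> fx fy fz xy yz xz.
have wF u : u \in F -> u \in weightX by case/fixed_weightsP.
have [w hw [wx wy wz]] := @triple_standard x y z true (wF _ fx) (wF _ fy) (wF _ fz) xy yz xz.
rewrite /= in wz.
have [||c hc|h1 h2] := @standard_pos (B :^ w)%G.
- by rewrite -(conjGid hw) conjSg.
- by rewrite abelianJ.
- move: hc; rewrite /pos_base [unzip1 _]/= !in_cons in_nil orbF => /or3P[] /eqP->.
  + by rewrite -wx; apply: fixed_weights_conj.
  + by rewrite -wy; apply: fixed_weights_conj.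
  + by rewrite -wz; apply: fixed_weights_conj.
rewrite cardJg in h1 h2; split=> // /h2; apply: leq_trans; exact: card_fixed_weights_conj.
Qed.

Lemma fixed_neg x y z : x \in F -> y \in F -> z \in F ->
  q x y = 8 -> q y z = 8 -> q x z = -8 ->
  (#|B| <= 18)%N /\ ((8 < #|F|)%N -> (#|B| <= 6)%N /\ ((2 < #|B|)%N -> (#|F| <= 20)%N)).
Proof.
move=> fx fy fz xy yz xz.
have wF u : u \in F -> u \in weightX by case/fixed_weightsP.
have [w hw [wx wy wz]] := @triple_standard x y z false (wF _ fx) (wF _ fy) (wF _ fz) xy yz xz.
rewrite /= in wz.
have [||c hc|h1 h2] := @standard_neg (B :^ w)%G.
- by rewrite -(conjGid hw) conjSg.
- by rewrite abelianJ.
- move: hc; rewrite /neg_base [unzip1 _]/= !in_cons in_nil orbF => /or3P[] /eqP->.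
  + by rewrite -wx; apply: fixed_weights_conj.
  + by rewrite -wy; apply: fixed_weights_conj.
  + by rewrite -wz; apply: fixed_weights_conj.
rewrite cardJg in h1; split=> // f8.
have [x' [y' [z' [[fx' fy' fz'] [xy' yz' xz']]]]] := h2 (leq_trans f8 (card_fixed_weights_conj _ hw)).
have back u : u \in fixed_weights (B :^ w)%g -> (w^-1)%g u \in F.
  by rewrite -(groupV WE7) in hw => /(fixed_weights_conj hw); rewrite -conjsgM mulgV conjsg1.
apply: (fixed_pos (back _ fx') (back _ fy') (back _ fz')); rewrite q_iso ?groupV //.
Qed.

(** The fixed weights are closed under negation, so the signs of [y] and [z] can be chosen to make
    two of the products 1/2; the sign of the third separates the two cases. *)
Lemma fixed_triple x y z : x \in F -> y \in F -> z \in F ->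
  [/\ x != y, x != neg y, y != z & y != neg z] -> x != z -> x != neg z ->
  ((#|B| <= 6)%N /\ ((2 < #|B|)%N -> (#|F| <= 20)%N)) \/ ((#|B| <= 18)%N /\ (#|F| <= 8)%N).
Proof.
move=> fx fy fz [nxy nxy' nyz nyz'] nxz nxz'.
have wF u : u \in F -> u \in weightX by case/fixed_weightsP.
have fN u : u \in F -> neg u \in F by rewrite /F fixed_weights_neg.
have [y' [fy' xy' nyz1 nyz1']] : exists y', [/\ y' \in F, q x y' = 8, y' != z & y' != neg z].
  have [h|h] := q_weights (wF _ fx) (wF _ fy) nxy nxy'; first by exists y.
  exists (neg y); split; rewrite ?fN ?q_negr ?h //.
    by apply: contra nyz' => /eqP <-; rewrite negK.
  by rewrite (inj_eq (can_inj negK)).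
have [z' [fz' yz' nxz1 nxz1']] : exists z', [/\ z' \in F, q y' z' = 8, x != z' & x != neg z'].
  have [h|h] := q_weights (wF _ fy') (wF _ fz) nyz1 nyz1'; first by exists z.
  by exists (neg z); split; rewrite ?fN ?q_negr ?h ?negK.
have [h|h] := q_weights (wF _ fx) (wF _ fz') nxz1 nxz1'.
  by left; apply: fixed_pos fx fy' fz' xy' yz' h.
have [h1 h2] := fixed_neg fx fy' fz' xy' yz' h.
by have [h8|h8] := ltnP 8 #|F|; [left; apply: h2|right].
Qed.
End FixedTriple.

(** * Abelian subgroups of order at least 128 are 2-groups *)

Lemma neg_neq x : x \in weightX -> neg x != x.
Proof.
by move=> hx; apply/eqP => e; have := q_negl x x; rewrite e q_weight //.
Qed.

(** If g x = -x, then every odd power of g also sends x to -x. *)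
Lemma odd_pow_neg (g : {perm X}) x n : g \in WE7 -> odd n -> (g ^+ n = 1)%g ->
  x \in weightX -> g x != neg x.
Proof.
move=> hg on gn hx; apply/eqP => e.
have p m : (g ^+ m)%g x = if odd m then neg x else x.
  elim: m => [|m IH]; first by rewrite expg0 perm1.
  by rewrite expgSr permM IH /=; case: (odd m); rewrite ?neg_iso // e negK.
by have := neg_neq hx; have := p n; rewrite on gn perm1 => <-; rewrite eqxx.
Qed.

Lemma large_abelian_2group (A : {group {perm X}}) :
  A \subset WE7 -> abelian A -> (128 <= #|A|)%N -> (2.-group A)%g.
Proof.
move=> sA abA cA; apply/pgroupP => p pr_p pA; rewrite inE; apply/negPn/negP => p2.
have [g gA og] := Cauchy pr_p pA; have hg := subsetP sA _ gA.
have odp : odd p by case: (even_prime pr_p) p2 => [->|].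
have gp : (g ^+ p = 1)%g by rewrite -og expg_order.
have [x xw gx] : exists2 x, x \in weightX & g x != x.
  apply/exists_inP; apply: contraTT isT => /exists_inPn h.
  have g1 : g = 1%g by apply: fix_weights => // y /h; rewrite negbK => /eqP.
  by move: (prime_gt1 pr_p); rewrite -og g1 order1.
pose B := 'C_A[x | 'P]%G; have sBA : B \subset A by rewrite subsetIl.
have sB : B \subset WE7 := subset_trans sBA sA.
have abB := abelianS sBA abA.
have fO y : y \in orbit 'P A x -> y \in fixed_weights B.
  case/imsetP => a aA ->; rewrite /= apermE; apply/fixed_weightsP; split.
    by rewrite weight_iso // (subsetP sA).
  move=> b bB; have bA := subsetP sBA _ bB.
  move: bB; rewrite inE => /andP[_ /astab1P /= e]; rewrite apermE in e.
  by rewrite -permM -(centsP abA _ bA _ aA) permM e.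
have cAB : (#|orbit 'P A x| * #|B| = #|A|)%N by rewrite card_orbit_stab.
have sOF : (#|orbit 'P A x| <= #|fixed_weights B|)%N by apply/subset_leq_card/subsetP.
have gO m : (g ^+ m)%g x \in orbit 'P A x by apply: (mem_orbit 'P); rewrite groupX.
have inO m := fO _ (gO m).
have pw m : (g ^+ m)%g x \in weightX by rewrite weight_iso // groupX.
have g2p : ((g ^+ 2) ^+ p = 1)%g by rewrite expgAC gp expg1n.
have hg2 : (g ^+ 2)%g \in WE7 by rewrite groupX.
(* As p + 1 is even, a point fixed by g^2 is fixed by g^(p+1) = g. *)
have n02 : (g ^+ 2)%g x != x.
  apply: contra gx => /eqP e; have : (g ^+ p.+1)%g x = x.
    have -> : p.+1 = (2 * (p.+1)./2)%N by rewrite mul2n -[LHS]odd_double_half oddS odp.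
    rewrite expgM; move: (p.+1./2) => k.
    by elim: k => [|k IH]; rewrite ?expg0 ?perm1 // expgSr permM IH.
  by rewrite expgS gp mulg1 => ->.
have n12 : (g ^+ 2)%g x != g x by rewrite expgS expg1 permM (inj_eq perm_inj).
have n12' : (g ^+ 2)%g x != neg (g x).
  by rewrite expgS expg1 permM (odd_pow_neg hg odp gp) // weight_iso.
have fx : x \in fixed_weights B by have := inO 0%N; rewrite expg0 perm1.
have fgx : g x \in fixed_weights B by have := inO 1%N; rewrite expg1.
rewrite -cAB in cA.
have ngx := odd_pow_neg hg odp gp xw; have ng2x := odd_pow_neg hg2 odp g2p xw.
have [[B6 FB]|[B18 F8]] := fixed_triple sB abB (inO 2) fgx fx (And4 n12 n12' gx ngx) n02 ng2x.
  (* The order of A is at most 20 * 6 = 120 in one case and 56 * 2 = 112 in the other. *)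
  have [B2|B2] := ltnP 2 #|B|.
    by have := leq_trans cA (leq_mul (leq_trans sOF (FB B2)) B6).
  have O56 : (#|orbit 'P A x| <= 56)%N.
    rewrite -card_weightX; apply: subset_leq_card; apply/subsetP => y /fO.
    by case/fixed_weightsP.
  by have := leq_trans cA (leq_mul O56 B2).
(* 8 * 18 = 144 is not below 128, but 7 * 18 = 126 is, so the orbit has exactly 8 elements. As A is
   abelian and g moves x, g fixes none of them, and p would divide 8. *)
have O8 := leq_trans sOF F8.
have eO : #|orbit 'P A x| = 8%N.
  apply/eqP; rewrite eqn_leq O8 leqNgt; apply/negP; rewrite ltnS => O7.
  by have := leq_trans cA (leq_mul O7 B18).
have pg : (p.-group <[g]>)%g by rewrite /pgroup -orderE og pnat_id.
have actO : [acts <[g]>%g, on orbit 'P A x | 'P].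
  by apply: subset_trans (acts_orbit _ _ _); rewrite ?cycle_subG ?subsetT.
have := pgroup_fix_mod pg actO; rewrite (_ : 'Fix_(orbit 'P A x | 'P)(<[g]>)%g = set0).
  rewrite cards0 eO => /eqP; rewrite mod0n -/(dvdn p 8) -[8%N]/(2 ^ 3)%N.
  by rewrite Euclid_dvdX // => /andP[]; rewrite dvdn_prime2 // (negPf p2).
apply/eqP; rewrite -subset0; apply/subsetP => y /setIP[/imsetP[a aA ->] /afixP/(_ g (cycle_id g))].
rewrite /= !apermE -permM -(centsP abA _ gA _ aA) permM => /perm_inj e.
by rewrite e eqxx in gx.
Qed.

(** * Frames *)

(* Coordinates 0, ..., 6, 7 stand for the points 0, ..., 6, oo of the projective line over
   F_7, and {1, 2, 4} is the set of nonzero squares. *)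
Definition beta_bits (t : nat) : bitseq :=
  mkseq (fun k => (k == 7) || ((k + 7 - t) %% 7 \in [:: 1; 2; 4])%N) 8.
Definition beta_code (t : nat) : code := two_val (Posz 2) (Negz 1) (beta_bits t).
#[global] Arguments beta_code : simpl never.

(** One root from each of the 63 opposite pairs. Complementary four-element sets give opposite
    roots, and the set containing coordinate 0 is kept. *)
Definition pos_roots : seq code :=
  [seq diff_code p.1 p.2 | p <- [seq (i, j) | i <- iota 0 8, j <- iota 0 8] & (p.1 < p.2)%N]
  ++ [seq two_val (Posz 2) (Negz 1) s | s <- subsets_code 4 & head false s].

Definition pair_index (c : code) : nat :=
  find (fun d => if ceq c d then true else ceq (ncode c) d) pos_roots.

Definition reflection_row (b : code) : seq nat :=
  [seq pair_index (rcode b c) | c <- pos_roots].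
Definition reflection_rows : seq (seq nat) := map reflection_row pos_roots.

(** Sorting makes the list canonical, so that equal frames are equal lists. *)
Definition image_by (r F : seq nat) : seq nat := sort leq [seq nth 0%N r k | k <- F].

Definition frame0 : seq nat := sort leq [seq pair_index (beta_code t) | t <- iota 0 7].

Definition seq_eqn := fix f (s t : seq nat) : bool :=
  match s, t with
  | a :: s', b :: t' => if eqn a b then f s' t' else false
  | [::], [::] => true | _, _ => false end.

Definition insert_new (acc : seq (seq nat) * seq (seq nat)) (F : seq nat) :=
  if lazy_has (seq_eqn F) acc.2 then acc else (F :: acc.1, F :: acc.2).

(** Breadth-first search with fuel [n]. That the outcome is closed under all reflections is not
    inferred from the search but checked in [frames_closed]. *)
Fixpoint grow (rows : seq (seq nat)) (n : nat) (new seen : seq (seq nat)) : seq (seq nat) :=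
  if n is n'.+1 then
    let r := foldl insert_new ([::], seen) [seq image_by r F | F <- new, r <- rows] in
    if r.1 is [::] then r.2 else grow rows n' r.1 r.2
  else seen.

(* Generators moving [frame0] to every frame. *)
Definition frame_rows : seq (seq nat) :=
  let R := reflection_rows in take 7 R ++ [:: last [::] R].

Definition all_frames : seq (seq nat) :=
  grow frame_rows 30 [:: frame0] [:: frame0].

(* Opaque, so that unification never enumerates the 135 frames. *)
Lemma frames_def : {L | L = all_frames}.
Proof. by exists all_frames. Qed.
Definition frames := sval frames_def.
Lemma framesE : frames = all_frames.
Proof. exact: (svalP frames_def). Qed.

Definition frame_set (F : seq nat) : {set X} :=
  [set x | (val x \in rootsE7) && (pair_index (cd x) \in F)].

Definition frame_sets : {set {set X}} := [set E in map frame_set frames].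

Lemma pos_roots_mem : all (fun c => cmem c root_codes) pos_roots.
Proof. by vm_compute. Qed.
Lemma pos_roots_sub c : c \in pos_roots -> c \in root_codes.
Proof. by move=> h; have := allP pos_roots_mem _ h; rewrite cmemE. Qed.

Lemma root_code_sign :
  all (fun c => if cmem c pos_roots then true else cmem (ncode c) pos_roots) root_codes.
Proof. by vm_compute. Qed.

Lemma pair_index_nth : all (fun k => eqn (pair_index (nth [::] pos_roots k)) k) (iota 0 63).
Proof. by vm_compute. Qed.

Lemma reflection_rows_ok :
  all (fun b => let r := reflection_row b in
    all (fun c => eqn (pair_index (rcode b c)) (nth 0%N r (pair_index c))) root_codes) pos_roots.
Proof. by vm_compute. Qed.

Lemma frame_rows_sub :
  let R := reflection_rows in all (fun r => lazy_has (seq_eqn r) R) frame_rows.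
Proof. by vm_compute. Qed.

Lemma frames_closed :
  let R := reflection_rows in let L := all_frames in
  all (fun r => all (fun F => lazy_has (seq_eqn (image_by r F)) L) L) R.
Proof. by vm_compute. Qed.

Lemma frames_sorted : all (fun F => sorted ltn F && all (fun k => k < 63)%N F) frames.
Proof. by rewrite framesE; vm_compute. Qed.

Lemma size_frames : size frames = 135%N.
Proof. by rewrite framesE; vm_compute. Qed.

Lemma uniq_frames : uniq frames.
Proof. by rewrite framesE; vm_compute. Qed.

Opaque pos_roots reflection_rows frame_rows.

Lemma seq_eqnE s t : seq_eqn s t = (s == t).
Proof.
by elim: s t => [|a s IH] [|b t] //=; rewrite eqseq_cons IH -eqnE; case: eqn.
Qed.

Lemma reflp_opp b : b \in rootsE7 -> - b \in rootsE7 -> reflp (- b) = reflp b.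
Proof.
move=> hb hn; apply/permP => x; apply: val_inj; rewrite !reflpE // !reflE //.
by rewrite ipNr scalerN scaleNr opprK.
Qed.

Lemma reflections_pos g : g \in reflections ->
  exists2 b, b \in pos_roots & g = reflp (dec b).
Proof.
case/imsetP => x xr ->; have hx : val x \in rootsE7 := xr.
have := allP root_code_sign _ (etrans (esym (val_root x)) hx); rewrite !cmemE.
case: ifP => [h _|_ h]; first by exists (cd x); rewrite ?dec_cd.
exists (ncode (cd x)) => //; have hn := roots_codes (pos_roots_sub h).
by rewrite -(val_pc hn) -/(neg x) val_neg reflp_opp // -val_neg val_root pcK // pos_roots_sub.
Qed.

Lemma cd_reflp b x : b \in root_codes -> cd (reflp (dec b) x) = rcode b (cd x).
Proof.
move=> hb; have [hm e] := rcodeP hb (cd_mem x).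
apply: dec_injective; rewrite ?size_cd ?codes8 // dec_cd e reflpE ?dec_cd //.
by rewrite rootsE7_dec map_f.
Qed.

Lemma frame_set_image b F : b \in pos_roots -> all (fun k => k < 63)%N F ->
  ('P^*%act (frame_set F) (reflp (dec b)) = frame_set (image_by (reflection_row b) F))%g.
Proof.
move=> hb F63; have hbr := pos_roots_sub hb.
have br : dec b \in rootsE7 by rewrite rootsE7_dec map_f.
have gW := reflp_W br; set g := reflp (dec b).
have idx x : val x \in rootsE7 ->
    pair_index (cd (g x)) = nth 0%N (reflection_row b) (pair_index (cd x)).
  rewrite val_root => hx; rewrite cd_reflp //; apply/eqP; rewrite -eqnE.
  exact: (allP (allP reflection_rows_ok _ hb) _ hx).
have gK x : g (g x) = x by apply: val_inj; rewrite !reflpE // refl_refl.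
apply/setP => y; apply/imsetP/idP => [[x]|].
  rewrite !inE /= => /andP[hx xF] ->; rewrite apermE root_iso // hx idx // mem_sort.
  exact: map_f.
rewrite inE mem_sort => /andP[hy /mapP[k kF e]].
exists (g y); last by rewrite /= apermE gK.
rewrite inE root_iso // hy idx // e.
have k63 : (k < 63)%N := allP F63 _ kF.
have hc : nth [::] pos_roots k \in pos_roots by rewrite mem_nth.
have hcr := pos_roots_sub hc; have hcc := roots_codes hcr.
have ki : pair_index (nth [::] pos_roots k) = k.
  by apply/eqP; rewrite -eqnE; apply: (allP pair_index_nth); rewrite mem_iota.
have xr : val (pc (nth [::] pos_roots k)) \in rootsE7 by rewrite val_root pcK.
have gxr : val (g (pc (nth [::] pos_roots k))) \in rootsE7 by rewrite root_iso.
have := idx _ xr; rewrite pcK // ki => <-.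
by rewrite -idx // gK pcK // ki.
Qed.

Lemma frame63 F : F \in frames -> all (fun k => k < 63)%N F.
Proof. by move=> /(allP frames_sorted)/andP[]. Qed.

Lemma reflection_row_mem b : b \in pos_roots -> reflection_row b \in reflection_rows.
Proof. exact: map_f. Qed.

Lemma frame_sets_act : [acts WE7, on frame_sets | 'P^*]%g.
Proof.
rewrite gen_subG; apply/subsetP => g /reflections_pos[b hb ->].
apply/setIP; split; first by rewrite in_setT.
rewrite in_set; apply/subsetP => E; rewrite in_set => /mapP[F hF ->].
have := hF; rewrite framesE => /(allP (allP frames_closed _ (reflection_row_mem hb))).
rewrite lazy_hasE -framesE => /hasP[F' hF']; rewrite seq_eqnE => /eqP eF.
rewrite in_set (frame_set_image hb (frame63 hF)) in_set eF; exact: map_f.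
Qed.

Lemma frame_set_inj : {in frames &, injective frame_set}.
Proof.
move=> F F' hF hF' /setP e.
have /andP[sF aF] := allP frames_sorted _ hF.
have /andP[sF' aF'] := allP frames_sorted _ hF'.
apply: (irr_sorted_eq ltn_trans ltnn) => // k.
have [k63|k63] := ltnP k 63; last first.
  apply/idP/idP => [/(allP aF)|/(allP aF')]; by rewrite ltnNge k63.
have hc : nth [::] pos_roots k \in pos_roots by rewrite mem_nth.
have := e (pc (nth [::] pos_roots k)); rewrite !inE val_root.
rewrite pcK ?roots_codes ?pos_roots_sub //.
suff -> : pair_index (nth [::] pos_roots k) = k by [].
by apply/eqP; rewrite -eqnE; apply: (allP pair_index_nth); rewrite mem_iota.
Qed.

Lemma card_frame_sets : #|frame_sets| = 135%N.
Proof.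
rewrite cardsE -size_frames -(size_map frame_set); apply/card_uniqP.
by rewrite map_inj_in_uniq ?uniq_frames //; apply: frame_set_inj.
Qed.

(** The induction principle of the search; it serves to show that each frame found is the image of
    [frame0] under an element of W. *)
Lemma grow_ind (P : seq nat -> Prop) rows n new seen :
  (forall r F, r \in rows -> P F -> P (image_by r F)) ->
  (forall F, F \in new -> P F) -> (forall F, F \in seen -> P F) ->
  forall F, F \in grow rows n new seen -> P F.
Proof.
move=> Pr; elim: n new seen => [//|n IH] new seen Pn Ps /=.
set im := flatten _; have Pim F : F \in im -> P F.
  by case/allpairsPdep => F' [r [h1 h2 ->]]; apply: Pr => //; apply: Pn.
have Pfold s acc : (forall F, F \in s -> P F) ->
    (forall F, F \in acc.1 -> P F) -> (forall F, F \in acc.2 -> P F) ->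
    (forall F, F \in (foldl insert_new acc s).1 -> P F) /\
    (forall F, F \in (foldl insert_new acc s).2 -> P F).
  elim: s acc => [//|G s IHs] acc Psq P1 P2 /=.
  have PG : P G by apply: Psq; rewrite inE eqxx.
  apply: IHs => [F h|F|F]; first by apply: Psq; rewrite inE h orbT.
    by rewrite /insert_new; case: ifP => _ /=; [exact: P1|rewrite inE => /orP[/eqP->|/P1]].
  by rewrite /insert_new; case: ifP => _ /=; [exact: P2|rewrite inE => /orP[/eqP->|/P2]].
have [P1 P2] := Pfold im ([::], seen) Pim (fun F h => False_ind _ (notF h)) Ps.
case E: (foldl _ _ _).1 => [|G s] F; first exact: P2.
by apply: IH => // F'; rewrite -E; apply: P1.
Qed.

(** 63 is the value that [pair_index] takes on a list that is not a root up to sign; the bound keeps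
    all indices meaningful. *)
Lemma image_by_63 r F : r \in reflection_rows -> all (fun k => k < 63)%N F ->
  all (fun k => k < 63)%N (image_by r F).
Proof.
move=> /mapP[b hb ->] F63; rewrite all_sort all_map; apply/allP => k hk /=.
have k63 : (k < 63)%N := allP F63 _ hk.
rewrite (nth_map [::]) //.
have hc : nth [::] pos_roots k \in pos_roots by rewrite mem_nth.
have hcr := pos_roots_sub hc; have hcc := roots_codes hcr.
have := rcodeP (pos_roots_sub hb) hcc.
have br : dec b \in rootsE7 by rewrite rootsE7_dec map_f ?pos_roots_sub.
move=> [hm e]; have : rcode b (nth [::] pos_roots k) \in root_codes.
  have := cd_reflp (pc (nth [::] pos_roots k)) (pos_roots_sub hb).
  rewrite (pcK hcc) => <-.
  by rewrite -val_root root_iso ?reflp_W // val_root pcK.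
move=> hr; have := allP root_code_sign _ hr; rewrite !cmemE => h.
rewrite -[63%N]/(size pos_roots) -has_find; apply/hasP.
case: ifP h => [h _|_ h]; first by exists (rcode b (nth [::] pos_roots k)); rewrite // !ceqE eqxx.
by exists (ncode (rcode b (nth [::] pos_roots k))); rewrite // !ceqE eqxx if_same.
Qed.

Lemma frame0_63 : all (fun k => k < 63)%N frame0.
Proof. by vm_compute. Qed.

Lemma frames_conj F : F \in frames ->
  exists2 w, w \in WE7 & ('P^*%act (frame_set frame0) w = frame_set F)%g.
Proof.
move=> hF; suff [] : all (fun k => k < 63)%N F /\
  exists2 w, w \in WE7 & ('P^*%act (frame_set frame0) w = frame_set F)%g by [].
move: F hF; rewrite framesE; apply: grow_ind.
- move=> r F hr [F63 [w hw e]].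
  have rR : r \in reflection_rows.
    have := allP frame_rows_sub _ hr; rewrite lazy_hasE => /hasP[r' hr'].
    by rewrite seq_eqnE => /eqP->.
  split; first exact: image_by_63.
  case/mapP: rR => b hb ->; exists (w * reflp (dec b))%g.
    by rewrite groupM // reflp_W // rootsE7_dec map_f // pos_roots_sub.
  by rewrite actM e frame_set_image.
all: move=> F; rewrite inE => /eqP ->; split; first exact: frame0_63.
all: by exists 1%g; rewrite ?group1 // act1.
Qed.

Lemma fixes_frame (P : {group {perm X}}) : P \subset WE7 -> (2.-group P)%g ->
  exists2 w, w \in WE7 &
    forall g, g \in (P :^ w)%g -> ('P^*%act (frame_set frame0) g = frame_set frame0)%g.
Proof.
move=> sP pP; have := pgroup_fix_mod pP (subset_trans sP frame_sets_act).
rewrite card_frame_sets; have [->|[E /setIP[]]] := set_0Vmem ('Fix_(frame_sets | 'P^*)(P))%g.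
  by rewrite cards0.
rewrite in_set => /mapP[F hF ->] /afixP fixF _.
have [w hw e] := frames_conj hF.
exists w^-1%g; rewrite ?groupV // => _ /imsetP[g gP ->].
by rewrite conjgE invgK !actM e fixF // -e actK.
Qed.

Opaque reflection_rows frame_rows frame0.

(** * The stabiliser of the standard frame *)

Definition beta_codes : seq code := map beta_code (iota 0 7).

Lemma beta_codes_roots : all (fun c => cmem c root_codes) beta_codes.
Proof. by vm_compute. Qed.
Lemma beta_separates : separates beta_codes.
Proof. by vm_compute. Qed.
Lemma beta_orthogonal : all (fun i => all (fun j =>
  if eqn i j then true else ieq (dot (beta_code i) (beta_code j)) (Posz 0)) (iota 0 7)) (iota 0 7).
Proof. by vm_compute. Qed.
Lemma frame0E : all (fun c => (pair_index c \in frame0) ==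
  lazy_has (fun t => ceq c (beta_code t) || ceq c (ncode (beta_code t))) (iota 0 7)) root_codes.
Proof. by vm_compute. Qed.

Definition frame_root (i : 'I_7) : X := pc (beta_code i).
Notation bt := frame_root.

Lemma beta_root (i : 'I_7) : beta_code i \in root_codes.
Proof.
have h : beta_code i \in beta_codes by apply: map_f; rewrite mem_iota ltn_ord.
by have := allP beta_codes_roots _ h; rewrite cmemE.
Qed.
Lemma beta_in_codes (i : 'I_7) : beta_code i \in codes.
Proof. exact/roots_codes/beta_root. Qed.
Lemma cd_bt i : cd (bt i) = beta_code i.
Proof. exact/pcK/beta_in_codes. Qed.
Lemma bt_root i : val (bt i) \in rootsE7.
Proof. by rewrite val_root cd_bt beta_root. Qed.

Lemma q_bt i j : q (bt i) (bt j) = if i == j then 32 else 0.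
Proof.
case: eqP => [<-|/eqP nij]; first by rewrite q_root ?bt_root.
have := allP (allP beta_orthogonal i _) j _; rewrite !mem_iota !ltn_ord => /(_ isT isT).
rewrite eqnE (inj_eq val_inj) (negPf nij) ieqE => /eqP e.
by rewrite /q !cd_bt.
Qed.

Lemma bt_inj : injective bt.
Proof.
by move=> i j e; have := q_bt i j; rewrite e q_bt eqxx; case: (i =P j).
Qed.

Lemma bt_neq_neg i j : bt i != neg (bt j).
Proof.
apply/eqP => e; have := q_bt i j; have := q_bt j j; rewrite e q_negl eqxx => ->.
by case: (i == j).
Qed.

(** The seven frame roots are an orthogonal basis of the space of E7. *)
Lemma eq_on_frame (x y : X) : (forall i, q x (bt i) = q y (bt i)) -> x = y.
Proof.
move=> h; apply: (separatesP beta_separates) => d /mapP[t]; rewrite mem_iota => /andP[_ lt] ->.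
  exact: (beta_in_codes (Ordinal lt)).
exact: (h (Ordinal lt)).
Qed.

Lemma fix_frame (g h : {perm X}) : g \in WE7 -> h \in WE7 ->
  (forall i, g (bt i) = h (bt i)) -> g = h.
Proof.
move=> hg hh e; apply/permP => x; rewrite -[g x](permKV h); congr (h _).
apply: eq_on_frame => i; rewrite -(q_iso _ _ hh) permKV -e q_iso //.
Qed.

Lemma mem_frame0 x :
  reflect (exists i, x = bt i \/ x = neg (bt i)) (x \in frame_set frame0).
Proof.
rewrite in_set; apply: (iffP andP) => [[xr]|[i hx]].
  have := allP frame0E _ (etrans (esym (val_root x)) xr) => /eqP ->.
  rewrite lazy_hasE => /hasP[t]; rewrite mem_iota => /andP[_ lt].
  rewrite !ceqE => /orP[] /eqP e; exists (Ordinal lt); [left|right].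
    by rewrite -(cdK x) e.
  by rewrite -(cdK x) e (ncode_pc (beta_in_codes (Ordinal lt))).
have xr : val x \in rootsE7.
  by case: hx => ->; rewrite ?root_normE ?q_negl ?q_negr ?opprK -?root_normE bt_root.
have := allP frame0E _ (etrans (esym (val_root x)) xr) => /eqP ->; split=> //.
rewrite lazy_hasE; apply/hasP; exists (val i); first by rewrite mem_iota ltn_ord.
rewrite !ceqE; case: hx => ->; first by rewrite cd_bt eqxx.
suff -> : cd (neg (bt i)) = ncode (beta_code i) by rewrite eqxx orbT.
rewrite /neg pcK ?cd_bt //; have := allP ncode_ok _ (beta_in_codes i).
by rewrite cmemE.
Qed.

Definition frame_reflection (i : 'I_7) : {perm X} := reflp (val (bt i)).
Notation rf := frame_reflection.

Definition M0 : {group {perm X}} := (<<[set rf i | i : 'I_7]>>)%G.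

Lemma rf_W i : rf i \in WE7.
Proof. exact/reflp_W/bt_root. Qed.

Lemma rf_bt i j : rf i (bt j) = if i == j then neg (bt j) else bt j.
Proof.
apply: val_inj; rewrite reflpE ?bt_root // reflE ?bt_root // ip_q q_bt eq_sym.
case: eqP => [->|_]; last by rewrite mul0r scale0r subr0.
rewrite val_neg -[32%:~R]/(32%:R) [X in X *: _](_ : _ = 2%:R); last by field.
by rewrite scaler_nat mulr2n opprD addrA subrr sub0r.
Qed.

Definition pair (i : 'I_7) : {set X} := [set bt i; neg (bt i)].

Lemma pairP i x : reflect (x = bt i \/ x = neg (bt i)) (x \in pair i).
Proof. exact: set2P. Qed.

Lemma pair_neg i x : (neg x \in pair i) = (x \in pair i).
Proof.
apply/pairP/pairP => -[e|e].
- by right; rewrite -e negK.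
- by left; apply: (can_inj negK).
- by right; rewrite e.
- by left; rewrite e negK.
Qed.

Lemma pair_bt i j : (bt i \in pair j) = (i == j).
Proof.
apply/pairP/eqP => [[/bt_inj //|/eqP]|->]; last by left.
by rewrite (negPf (bt_neq_neg _ _)).
Qed.

Definition sign_set : {set {perm X}} := [set g in WE7 | [forall i, g (bt i) \in pair i]].

Lemma sign_setP (g : {perm X}) :
  reflect (g \in WE7 /\ forall i, g (bt i) \in pair i) (g \in sign_set).
Proof.
rewrite inE; apply: (iffP andP) => -[h1 h2]; split=> //; last exact/forallP.
by move=> i; apply: (forallP h2).
Qed.

Lemma group_set_sign_set : group_set sign_set.
Proof.
apply/group_setP; split.
  by apply/sign_setP; split=> // i; rewrite perm1 pair_bt.
move=> g h /sign_setP[gW hg] /sign_setP[hW hh]; apply/sign_setP; split; first exact: groupM.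
by move=> i; rewrite permM; case/pairP: (hg i) => ->; rewrite ?neg_iso // ?pair_neg.
Qed.
Canonical sign_group := Group group_set_sign_set.

Lemma sign_elt (S : {set 'I_7}) : exists2 g, g \in M0 &
  forall i, g (bt i) = if i \in S then neg (bt i) else bt i.
Proof.
have [n] := ubnP #|S|; elim: n => // n IH in S *; rewrite ltnS => leS.
have [->|[j jS]] := set_0Vmem S.
  by exists 1%g => // i; rewrite perm1 inE.
have [|g gM gE] := IH (S :\ j); first by move: leS; rewrite (cardsD1 j S) jS.
exists (rf j * g)%g; first by rewrite groupM // mem_gen // imset_f.
have gW : g \in WE7.
  apply: (subsetP _ _ gM); rewrite gen_subG; apply/subsetP => _ /imsetP[i _ ->]; exact: rf_W.
move=> i; rewrite permM rf_bt; case: eqP => [<-|/eqP nji].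
  by rewrite neg_iso // gE !inE eqxx jS.
by rewrite gE !inE (eq_sym i) nji.
Qed.

Lemma M0E : M0 :=: sign_set.
Proof.
apply/eqP; rewrite eqEsubset gen_subG; apply/andP; split; apply/subsetP => g.
  case/imsetP => i _ ->; apply/sign_setP; split=> [|j]; first exact: rf_W.
  by rewrite rf_bt; case: ifP => _; rewrite ?pair_neg pair_bt.
case/sign_setP => gW hg; have [h hM hE] := sign_elt [set i | g (bt i) == neg (bt i)].
suff -> : g = h by [].
apply: fix_frame => // [|i].
  apply: (subsetP _ _ hM); rewrite gen_subG; apply/subsetP => _ /imsetP[i _ ->]; exact: rf_W.
by rewrite hE inE; case: eqP => [//|n]; case/pairP: (hg i).
Qed.

Lemma M0P (g : {perm X}) : reflect (g \in WE7 /\ forall i, g (bt i) \in pair i) (g \in M0).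
Proof. by rewrite M0E; apply: sign_setP. Qed.

Lemma M0_sub : M0 \subset WE7.
Proof. by apply/subsetP => g /M0P[]. Qed.

Definition signs (g : {perm X}) : {set 'I_7} := [set i | g (bt i) == neg (bt i)].

Lemma M0_bt g i : g \in M0 -> g (bt i) = if i \in signs g then neg (bt i) else bt i.
Proof.
by case/M0P => _ /(_ i)/pairP; rewrite inE; case: eqP => [//|n] [].
Qed.

Lemma signs_inj : {in M0 &, injective signs}.
Proof.
move=> g h hg hh e; apply: fix_frame; rewrite ?(subsetP M0_sub) // => i.
by rewrite (M0_bt i hg) (M0_bt i hh) e.
Qed.

Lemma card_M0 : #|M0| = (2 ^ 7)%N.
Proof.
have im : signs @: M0 = powerset [set: 'I_7]; last first.
  by rewrite -(card_in_imset signs_inj) im card_powerset cardsT card_ord.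
apply/setP => S; rewrite powersetT in_setT; apply/imsetP.
have [g gM gE] := sign_elt S; exists g => //; apply/setP => i; rewrite inE gE.
by case: ifP => _; rewrite ?eqxx // (negPf (bt_neq_neg _ _)).
Qed.

Lemma M0_mul_bt g h i : g \in M0 -> h \in M0 ->
  (g * h)%g (bt i) = if (i \in signs g) (+) (i \in signs h) then neg (bt i) else bt i.
Proof.
move=> hg hh; have hW := subsetP M0_sub _ hh.
rewrite permM (M0_bt i hg); case: (i \in signs g); last exact: (M0_bt i hh).
rewrite (neg_iso _ hW) (M0_bt i hh); case: (i \in signs h) => //=.
exact: negK.
Qed.

Lemma M0_abelem : (2.-abelem M0)%g.
Proof.
have M0W g := subsetP M0_sub g.
rewrite abelemE //; apply/andP; split.
  apply/centsP => g hg h hh; apply: fix_frame => [||i].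
  - exact: groupM (M0W _ hg) (M0W _ hh).
  - exact: groupM (M0W _ hh) (M0W _ hg).
  by rewrite (M0_mul_bt i hg hh) (M0_mul_bt i hh hg) addbC.
apply/exponentP => g hg; apply: fix_frame => [||i].
- exact: groupX (M0W _ hg).
- exact: group1.
by rewrite expgS expg1 (M0_mul_bt i hg hg) addbb perm1.
Qed.

(* A line is the set of frame roots not orthogonal to a given weight. *)
Definition line_of (c : code) : bitseq :=
  [seq ~~ ieq (dot c (beta_code t)) (Posz 0) | t <- iota 0 7].
Definition lines : seq bitseq := undup (map line_of weight_codes).

(** The subspaces of the Fano plane: with two points, [m] contains the line through them. *)
Definition closed_bits (m : bitseq) : bool :=
  all (fun l => if (2 <= count2 l m)%N then count2 l m == 3%N else true) lines.

Definition five_ok (m : bitseq) : bool :=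
  if closed_bits m then if (5 <= count id m)%N then all id m else true else true.
(** A proper subspace of the Fano plane has at most three points. Five is the number of points that
    a transposition would fix. *)
Lemma closed_bits_five : all five_ok (bitlists 7).
Proof. by vm_compute. Qed.

Definition triangle_ok (m : bitseq) : bool :=
  if closed_bits m then if all (nth false m) (iota 0 3) then all id m else true else true.
(** The points 0, 1, 2 do not lie on a line, hence generate the plane. *)
Lemma closed_bits_triangle : all triangle_ok (bitlists 7).
Proof. by vm_compute. Qed.

Lemma lines_fano : [&& size lines == 7%N, all (fun l => count id l == 3%N) lines,
  all (fun l => all (fun l' => if l == l' then true else count2 l l' == 1%N) lines) lines,
  all (fun t => count (fun l => nth false l t) lines == 3%N) (iota 0 7) &
  all (fun t => all (fun u => if t == u then true else
    count (fun l => nth false l t && nth false l u) lines == 1%N) (iota 0 7)) (iota 0 7)].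
Proof. by vm_compute. Qed.

Lemma line_weights :
  all (fun l => count (fun c => line_of c == l) weight_codes == 8%N) lines.
Proof. by vm_compute. Qed.

Lemma weight_bt_values : all (fun c => all (fun t => let e := dot c (beta_code t) in
  [|| ieq e (Posz 0), ieq e (Posz 16) | ieq e (Negz 15)]) (iota 0 7)) weight_codes.
Proof. by vm_compute. Qed.

Opaque lines.

Definition bits7 (S : {set 'I_7}) : bitseq := [seq i \in S | i <- enum 'I_7].

Lemma size_bits7 S : size (bits7 S) = 7%N.
Proof. by rewrite size_map size_enum_ord. Qed.

Lemma mem_bits7 S : bits7 S \in bitlists 7.
Proof. by rewrite -(size_bits7 S) mem_bitlists. Qed.

Lemma nth_bits7 S (i : 'I_7) : nth false (bits7 S) i = (i \in S).
Proof. by rewrite (nth_map i) ?size_enum_ord // nth_ord_enum. Qed.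

Lemma count_enum (T : finType) (P : pred T) : count P (enum T) = #|[set i | P i]|.
Proof. by rewrite -size_filter enumT cardsE cardE. Qed.

Lemma count_bits7 S : count id (bits7 S) = #|S|.
Proof. by rewrite /bits7 count_map count_enum; apply: eq_card => i; rewrite inE. Qed.

Lemma count2_bits7 S T : count2 (bits7 S) (bits7 T) = #|S :&: T|.
Proof. by rewrite /bits7 count2_map count_enum; apply: eq_card => i; rewrite !inE. Qed.

Lemma bits7_inj : injective bits7.
Proof. by move=> S T e; apply/setP => i; rewrite -!nth_bits7 e. Qed.

Definition weight_line (x : X) : {set 'I_7} := [set i | q x (bt i) != 0].

Lemma line_of_support x : line_of (cd x) = bits7 (weight_line x).
Proof.
rewrite /line_of -val_enum_ord -map_comp; apply: eq_map => i /=.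
by rewrite inE ieqE /q cd_bt.
Qed.

Lemma support_lines x : x \in weightX -> bits7 (weight_line x) \in lines.
Proof.
rewrite val_weight -line_of_support => h.
Transparent lines. rewrite /lines. Opaque lines.
by rewrite mem_undup map_f.
Qed.

Lemma lines_support l : l \in lines -> exists2 x, x \in weightX & l = bits7 (weight_line x).
Proof.
Transparent lines. rewrite /lines. Opaque lines.
rewrite mem_undup => /mapP[c hc ->]; exists (pc c); first by rewrite val_weight pcK ?weights_codes.
by rewrite -line_of_support pcK ?weights_codes.
Qed.

Lemma card_support x : x \in weightX -> #|weight_line x| = 3%N.
Proof.
move=> /support_lines h; have /and5P[_ /allP l3 _ _ _] := lines_fano.
by apply/eqP; rewrite -count_bits7; apply: (l3 _ h).
Qed.

Lemma support_meet x y : x \in weightX -> y \in weightX ->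
  (1 < #|weight_line x :&: weight_line y|)%N -> weight_line x = weight_line y.
Proof.
move=> /support_lines hx /support_lines hy; have /and5P[_ _ /allP ll _ _] := lines_fano.
have := allP (ll _ hx) _ hy; case: eqP => [/bits7_inj //|_].
by rewrite count2_bits7 => /eqP ->.
Qed.

Lemma pair_iso (g : {perm X}) x i j : g \in WE7 -> g (bt i) \in pair j -> x \in pair i ->
  g x \in pair j.
Proof. by move=> hg h /pairP[->|->] //; rewrite neg_iso // pair_neg. Qed.

Lemma pair_perm_inj (g : {perm X}) i j k : g \in WE7 ->
  g (bt i) \in pair k -> g (bt j) \in pair k -> i = j.
Proof.
move=> hg /pairP hi /pairP hj.
have : g (bt i) = g (bt j) \/ g (bt i) = g (neg (bt j)).
  rewrite neg_iso //; case: hi => ->; case: hj => ->; rewrite ?negK; by [left|right].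
case=> /perm_inj; first exact: bt_inj.
by move/eqP; rewrite (negPf (bt_neq_neg _ _)).
Qed.

Lemma support_iso (g : {perm X}) x i j : g \in WE7 -> g (bt i) \in pair j ->
  (j \in weight_line (g x)) = (i \in weight_line x).
Proof.
move=> hg /pairP h; rewrite !inE -(q_iso x (bt i) hg).
by case: h => ->; rewrite ?q_negr ?oppr_eq0.
Qed.

(** * Fixed points on the Fano plane *)

Definition stabilizes_frame (g : {perm X}) : Prop := forall i, exists j, g (bt i) \in pair j.

Definition fixed_pairs (g : {perm X}) : {set 'I_7} := [set i | g (bt i) \in pair i].

(** A line with two fixed points is sent to a line through both, hence to itself, and then its third
    point is fixed too. *)
Lemma closed_fixed_pairs (g : {perm X}) : g \in WE7 -> stabilizes_frame g ->
  closed_bits (bits7 (fixed_pairs g)).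
Proof.
move=> hg st; apply/allP => l /lines_support[x xw ->].
rewrite count2_bits7; case: ifP => // c2.
have gw : g x \in weightX by rewrite weight_iso.
have sg : weight_line (g x) = weight_line x.
  apply: support_meet => //; apply: leq_trans c2 _; apply: subset_leq_card.
  apply/subsetP => i /setIP[ix iF].
  have gi : g (bt i) \in pair i by move: iF; rewrite inE.
  by apply/setIP; rewrite (support_iso _ hg gi).
suff sub : weight_line x \subset fixed_pairs g by rewrite (setIidPl sub) card_support.
(* The image [d] of an unfixed point [c] of the line is a second unfixed point of it; with the two
   fixed points the line would have four. *)
apply/subsetPn => -[c cx cF]; have [d gd] := st c.
have nF : d \notin fixed_pairs g.
  apply: contra cF => dF; have gdd : g (bt d) \in pair d by move: dF; rewrite inE.
  by rewrite (pair_perm_inj hg gd gdd).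
have dc : d != c by apply: contra cF => /eqP e; rewrite inE -{2}e.
have dx : d \in weight_line x by rewrite -sg (support_iso _ hg gd).
have : (#|[set c; d]| <= #|weight_line x :\: fixed_pairs g|)%N.
  by apply: subset_leq_card; apply/subsetP => i /set2P[]->; rewrite inE ?cF ?nF.
have := cardsID (fixed_pairs g) (weight_line x); rewrite card_support // cards2 eq_sym dc.
by move: c2; move: #|_ :&: _| #|_ :\: _| => a b; lia.
Qed.

Lemma all_fixed_pairs (g : {perm X}) :
  g \in WE7 -> all id (bits7 (fixed_pairs g)) -> g \in M0.
Proof.
move=> hg /allP h; apply/M0P; split=> // i.
have : i \in fixed_pairs g by rewrite -nth_bits7; apply/h/mem_nth; rewrite size_bits7.
by rewrite in_set.
Qed.

Lemma fixed_five (g : {perm X}) : g \in WE7 -> stabilizes_frame g ->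
  (5 <= #|fixed_pairs g|)%N -> g \in M0.
Proof.
move=> hg st c5; apply: all_fixed_pairs => //.
have := allP closed_bits_five _ (mem_bits7 (fixed_pairs g)).
by rewrite /five_ok (closed_fixed_pairs hg st) count_bits7 c5.
Qed.

Lemma fixed_triangle (g : {perm X}) : g \in WE7 -> stabilizes_frame g ->
  (forall i : 'I_7, (i < 3)%N -> g (bt i) \in pair i) -> g \in M0.
Proof.
move=> hg st f3; apply: all_fixed_pairs => //.
have := allP closed_bits_triangle _ (mem_bits7 (fixed_pairs g)).
rewrite /triangle_ok (closed_fixed_pairs hg st).
suff -> : all (nth false (bits7 (fixed_pairs g))) (iota 0 3) by [].
apply/allP => k; rewrite mem_iota => /andP[_ k3].
have k7 : (k < 7)%N by apply: ltn_trans k3 _.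
by rewrite (nth_bits7 _ (Ordinal k7)) in_set; apply: f3.
Qed.

Lemma frame_stabilized (g : {perm X}) :
  ('P^*%act (frame_set frame0) g = frame_set frame0)%g -> stabilizes_frame g.
Proof.
move=> e i; have : g (bt i) \in frame_set frame0.
  rewrite -e; apply/imsetP; exists (bt i); last by rewrite /= apermE.
  by apply/mem_frame0; exists i; left.
by case/mem_frame0 => j h; exists j; apply/pairP.
Qed.

(** * Abelian subgroups stabilising the frame *)

Definition pairs : {set {set X}} := [set pair i | i : 'I_7].

Lemma pair_inj : injective pair.
Proof. by move=> i j e; apply/eqP; rewrite -pair_bt -e pair_bt. Qed.

Lemma card_pairs : #|pairs| = 7%N.
Proof. by rewrite card_imset ?card_ord //; apply: pair_inj. Qed.

Lemma pair_image (g : {perm X}) i j : g \in WE7 -> g (bt i) \in pair j ->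
  ('P^*%act (pair i) g = pair j)%g.
Proof.
move=> hg h; apply/eqP; rewrite eqEcard; apply/andP; split.
  by apply/subsetP => _ /imsetP[x xi ->]; rewrite /= apermE; apply: pair_iso xi.
by rewrite card_setact !cards2 ![_ != neg _]bt_neq_neg.
Qed.

Lemma pair_fixed (g : {perm X}) i : g \in WE7 ->
  ('P^*%act (pair i) g == pair i)%g = (g (bt i) \in pair i).
Proof.
move=> hg; apply/eqP/idP => [<-|h]; last exact: pair_image.
by apply/imsetP; exists (bt i); rewrite /= ?apermE ?pair_bt.
Qed.

Lemma abelian_frame_stabilizer (A : {group {perm X}}) : A \subset WE7 -> abelian A ->
  (forall g, g \in A -> stabilizes_frame g) -> (128 <= #|A|)%N -> A :=: M0.
Proof.
move=> sA abA stA cA; have hA g : g \in A -> g \in WE7 := subsetP sA g.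
have actA : [acts A, on pairs | 'P^*]%g.
  apply/subsetP => g gA; apply/setIP; split; first by rewrite in_setT.
  rewrite inE; apply/subsetP => _ /imsetP[i _ ->]; rewrite inE.
  by have [j hj] := stA g gA i; rewrite (pair_image (hA _ gA) hj) imset_f.
have fixA g : g \in A -> (g \in 'C(pairs | 'P^*)%g) = (g \in M0).
  move=> gA; apply/astabP/M0P => [h|[_ h] _ /imsetP[i _ ->]].
    split=> [|i]; first exact: hA.
    by rewrite -pair_fixed ?hA // h ?imset_f.
  by apply/eqP; rewrite pair_fixed ?hA.
have [le1 lt1] := abelian_index_orbits abA actA.
set orbs := [set _ | _ in _] in le1 lt1; rewrite card_pairs in le1 lt1.
(* A kernel element is determined by the set of frame roots that it negates. Since it commutes with
   [A], this set is a union of [A]-orbits, hence is determined by the set [h g] of orbits. *)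
have leC : (#|'C_A(pairs | 'P^*)%g| <= 2 ^ #|orbs|)%N.
  rewrite -card_powerset.
  pose h (g : {perm X}) : {set {set {set X}}} := [set orbit 'P^*%act A (pair i) | i in signs g].
  have inv g i j : g \in 'C_A(pairs | 'P^*)%g ->
      orbit 'P^*%act A (pair i) = orbit 'P^*%act A (pair j) -> j \in signs g -> i \in signs g.
    case/setIP => gA _ /orbit_eqP/imsetP[a aA /= e].
    have [k hk] := stA a aA j; have ak := pair_image (hA _ aA) hk.
    have {e ak} eik : k = i by apply: pair_inj; rewrite -ak e.
    rewrite {}eik in hk; rewrite !inE => /eqP gj.
    have gz : g (a (bt j)) = neg (a (bt j)).
      by rewrite -permM (centsP abA _ aA _ gA) permM gj neg_iso ?hA.
    case/pairP: hk gz => ->; first by move=> ->.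
    by rewrite neg_iso ?hA // => /(can_inj negK) ->.
  have hinj : {in 'C_A(pairs | 'P^*)%g &, injective h}.
    move=> g g' gC gC' e; have [gA gP] := setIP gC; have [gA' gP'] := setIP gC'.
    rewrite (fixA _ gA) in gP; rewrite (fixA _ gA') in gP'; apply: (signs_inj gP gP').
    have sub u v : u \in 'C_A(pairs | 'P^*)%g -> v \in 'C_A(pairs | 'P^*)%g -> h u = h v ->
        signs u \subset signs v.
      move=> uC vC euv; apply/subsetP => i iu.
      have : orbit 'P^*%act A (pair i) \in h v by rewrite -euv; apply/imsetP; exists i.
      by case/imsetP => j jv eo; apply: inv eo jv.
    by apply/eqP; rewrite eqEsubset (sub g g' gC gC' e) (sub g' g gC' gC (esym e)).
  rewrite -(card_in_imset hinj); apply: subset_leq_card; apply/subsetP => _ /imsetP[g gC ->].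
  rewrite inE; apply/subsetP => _ /imsetP[i _ ->]; apply: imset_f; exact: imset_f.
have [sC|nC] := boolP (A \subset 'C(pairs | 'P^*)%g).
  apply/eqP; rewrite eqEcard card_M0 cA andbT; apply/subsetP => g gA.
  by rewrite -fixA // (subsetP sC).
have nt : no_transposition 'P^*%act A pairs.
  move=> g _ _ gA /imsetP[i _ ->] <- ni.
  have [j hj] := stA g gA i; have gW := hA _ gA; rewrite (pair_image gW hj) in ni *.
  have nij : i != j by apply: contra ni => /eqP->.
  (* If [g] fixed the other five pairs, [fixed_five] would put it into [M0], whose elements move no
     pair. *)
  have : ~~ ([set: 'I_7] :\: [set i; j] \subset fixed_pairs g).
    apply: contra ni => sub; have gM : g \in M0.
      apply: fixed_five => //; first exact: stA.
      apply: leq_trans (subset_leq_card sub); rewrite -(leq_add2l #|[set i; j]|).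
      have := cardsID [set i; j] [set: 'I_7]; rewrite setTI cardsT card_ord => ->.
      by rewrite cards2 nij.
    by case/M0P: gM => _ /(_ i) gi; rewrite -(pair_image gW gi) (pair_image gW hj).
  case/subsetPn => k; rewrite in_setD in_set2 in_setT negb_or andbT in_set => /andP[ki kj] nf.
  exists (pair k); split; first exact: imset_f.
  - by rewrite (inj_eq pair_inj).
  - by rewrite (inj_eq pair_inj).
  - by rewrite (pair_fixed k gW).
(* The order of A is the product of the kernel and its index, and would be below 2^7. *)
have := leq_ltn_trans (leq_mul (leqnn _) leC) (lt1 nt nC).
rewrite mulnC Lagrange ?subsetIl //.
by rewrite ltnNge cA.
Qed.

Lemma maximal_abelian_conj (M : {group {perm X}}) : M \subset WE7 -> abelian M ->
  (forall H : {group {perm X}}, H \subset WE7 -> abelian H -> (#|H| <= #|M|)%N) ->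
  exists2 w, w \in WE7 & M :=: (M0 :^ w)%g.
Proof.
move=> sM abM maxM.
have cM : (128 <= #|M|)%N.
  by have := maxM M0 M0_sub (abelem_abelian M0_abelem); rewrite card_M0.
have pM := large_abelian_2group sM abM cM.
have [w hw fixw] := fixes_frame sM pM.
exists w^-1%g; rewrite ?groupV //.
have e : (M :^ w)%G :=: M0.
  apply: abelian_frame_stabilizer.
  - by rewrite -(conjGid hw) conjSg.
  - by rewrite abelianJ.
  - by move=> g /fixw/frame_stabilized.
  - by rewrite cardJg.
by rewrite -e /= conjsgK.
Qed.

Lemma q_weight_bt x i : x \in weightX ->
  [\/ q x (bt i) = 0, q x (bt i) = 16 | q x (bt i) = -16].
Proof.
rewrite val_weight /q cd_bt => h.
have := allP (allP weight_bt_values _ h) i; rewrite mem_iota ltn_ord => /(_ isT).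
by rewrite /= !ieqE => /or3P[] /eqP ->; [apply: Or31|apply: Or32|apply: Or33].
Qed.

(** The inner products of a weight with the frame roots are 0, 1 or -1. Two weights with the same
    line therefore have the same products up to signs, and [M0] contains all sign changes of the
    frame. *)
Lemma orbit_M0 x : x \in weightX ->
  orbit 'P M0 x = [set z in weightX | weight_line z == weight_line x].
Proof.
move=> xw; apply/setP => z; rewrite in_set; apply/orbitP/andP => [[g gM <-]|[zw /eqP e]].
  have gW := subsetP M0_sub _ gM; rewrite /= apermE weight_iso //; split=> //.
  by apply/eqP/setP => i; rewrite (@support_iso g x i i) //; case/M0P: gM.
pose S := [set i | q z (bt i) != q x (bt i)].
have [g gM gE] := sign_elt S; exists g => //=; rewrite apermE.
have gW := subsetP M0_sub _ gM.
apply: eq_on_frame => i; have := gE i; rewrite in_set.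
have := q_iso x (bt i) gW; case: eqP => [-> <- -> //|n h gi].
rewrite gi q_negr in h.
have /setP/(_ i) := e; rewrite !in_set => en.
have -> : q (g x) (bt i) = - q x (bt i) by rewrite -h opprK.
have [zz|zz|zz] := q_weight_bt i zw; have [xx|xx|xx] := q_weight_bt i xw;
  by rewrite zz xx in n en *.
Qed.

(** * The Fano plane *)

Definition line_sets : {set {set 'I_7}} := [set weight_line x | x in weightX].

Lemma uniq_lines : uniq lines.
Proof. by vm_compute. Qed.

Lemma card_line_sets (P : pred bitseq) :
  #|[set L in line_sets | P (bits7 L)]| = count P lines.
Proof.
rewrite -size_filter cardE -(size_map bits7); apply/perm_size/uniq_perm.
- by rewrite map_inj_uniq ?enum_uniq //; apply: bits7_inj.
- by rewrite filter_uniq ?uniq_lines.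
move=> l; rewrite mem_filter; apply/mapP/andP => [[L]|[Pl /lines_support[x xw e]]].
  rewrite mem_enum in_set => /andP[/imsetP[x xw ->] PL] ->; split=> //; exact: support_lines.
exists (weight_line x) => //; rewrite mem_enum in_set -e Pl andbT; exact: imset_f.
Qed.

Section Incidence.
Variable w : {perm X}.
Hypothesis hw : w \in WE7.

Definition beta (i : 'I_7) : vec := val (w (bt i)).
Let M := (M0 :^ w)%g.
Definition support_conj (z : X) : {set 'I_7} := weight_line ((w^-1)%g z).
Definition orbit_of_line (L : {set 'I_7}) : {set X} :=
  [set z in weightX | support_conj z == L].

Let hw' : (w^-1)%g \in WE7. Proof. by rewrite groupV. Qed.

Lemma mem_support_conj z i : (i \in support_conj z) = (ip (beta i) (val z) != 0).
Proof.
rewrite in_set -{2}(permKV w z) /beta ip_iso // ip_q qC.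
by rewrite mulf_eq0 intr_eq0 [X in _ || X](_ : _ = false) ?orbF.
Qed.

Lemma mem_orbit_of_line z L :
  (z \in orbit_of_line L) = (z \in weightX) && (support_conj z == L).
Proof. by rewrite in_set. Qed.

Lemma orbit_conj x : x \in weightX -> orbit 'P M x = orbit_of_line (support_conj x).
Proof.
move=> xw; have xw' : (w^-1)%g x \in weightX by rewrite weight_iso.
apply/setP => z; have /setP/(_ ((w^-1)%g z)) := orbit_M0 xw'.
rewrite in_set weight_iso // -/(support_conj z) -/(support_conj x) -mem_orbit_of_line => <-.
apply/orbitP/orbitP => -[g].
  case/imsetP => h hM ->; rewrite /= !apermE => <-; exists h => //.
  by rewrite /= apermE -{2}(permKV w x) permJ permK.
move=> gM /=; rewrite apermE => e; exists (g ^ w)%g; first by rewrite memJ_conjg.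
by rewrite /= apermE -{1}(permKV w x) permJ e permKV.
Qed.

Lemma orbit_of_line_inh L : L \in line_sets -> exists2 z, z \in orbit_of_line L & z \in weightX.
Proof.
case/imsetP => x xw ->; exists (w x); last by rewrite weight_iso.
by rewrite mem_orbit_of_line weight_iso // xw /support_conj permK eqxx.
Qed.

Lemma orbitsE : [set orbit 'P M x | x in weightX] = orbit_of_line @: line_sets.
Proof.
apply/setP => O; apply/imsetP/imsetP => [[x xw ->]|[L hL ->]].
  exists (support_conj x); last exact: orbit_conj.
  by apply: imset_f; rewrite weight_iso.
have [z] := orbit_of_line_inh hL; rewrite mem_orbit_of_line => /andP[zw /eqP <-] _.
by exists z; rewrite // orbit_conj.
Qed.

Lemma orbit_of_line_inj : {in line_sets &, injective orbit_of_line}.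
Proof.
move=> L L' hL _ e; have [z zL _] := orbit_of_line_inh hL.
have := zL; rewrite {1}e; move: zL; rewrite !mem_orbit_of_line => /andP[_ /eqP <-] /andP[_ /eqP //].
Qed.

Definition incident (i : 'I_7) (O : {set X}) : bool := [exists x in O, ip (beta i) (val x) != 0].

Lemma incident_line L i : L \in line_sets -> incident i (orbit_of_line L) = (i \in L).
Proof.
move=> hL; apply/exists_inP/idP => [[x]|iL].
  by rewrite mem_orbit_of_line -mem_support_conj => /andP[_ /eqP <-].
have [z zL _] := orbit_of_line_inh hL; exists z => //; rewrite -mem_support_conj.
by move: zL; rewrite mem_orbit_of_line => /andP[_ /eqP ->].
Qed.

Lemma card_orbits_incident (P : pred bitseq) (R : {set X} -> bool) :
  (forall L, L \in line_sets -> R (orbit_of_line L) = P (bits7 L)) ->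
  #|[set O in orbit_of_line @: line_sets | R O]| = count P lines.
Proof.
move=> h; rewrite -card_line_sets -[RHS](card_in_imset (f := orbit_of_line)); last first.
  by move=> L L' /[!in_set]/andP[hL _] /andP[hL' _]; apply: orbit_of_line_inj.
apply: eq_card => O; rewrite in_set; apply/andP/imsetP => [[/imsetP[L hL ->] RL]|[L]].
  by exists L; rewrite // in_set hL -h.
by rewrite in_set => /andP[hL PL] ->; rewrite imset_f // h.
Qed.

Lemma card_orbit_of_line L : L \in line_sets -> #|orbit_of_line L| = 8%N.
Proof.
move=> hL; rewrite -(card_imset _ (@perm_inj _ (w^-1)%g)).
have hl : bits7 L \in lines by case/imsetP: hL => x xw ->; apply: support_lines.
have /eqP <- := allP line_weights _ hl; rewrite -card_weights; apply: eq_card => x.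
rewrite in_set line_of_support (inj_eq bits7_inj).
apply/imsetP/andP => [[z]|[xw /eqP e]].
  rewrite mem_orbit_of_line => /andP[zw /eqP <-] ->.
  by split; [rewrite (weight_iso z hw')|exact: eqxx].
exists (w x); last by rewrite permK.
rewrite mem_orbit_of_line (weight_iso x hw) xw /support_conj permK e; exact: eqxx.
Qed.

Lemma fano_plane :
  let orbs := [set orbit 'P M x | x in weightX] in
  [/\ #|orbs| = 7%N /\ (forall O, O \in orbs -> #|O| = 8%N),
      forall O, O \in orbs -> forall i x y, x \in O -> y \in O ->
        (ip (beta i) (val x) != 0) = (ip (beta i) (val y) != 0),
      forall O, O \in orbs -> #|[set i | incident i O]| = 3%N,
      forall i, #|[set O in orbs | incident i O]| = 3%N
    & forall i j, i != j -> #|[set O in orbs | incident i O && incident j O]| = 1%N].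
Proof.
have /and5P[/eqP l7 l3 _ p3 pp1] := lines_fano.
rewrite /= orbitsE; split.
- split; last by move=> _ /imsetP[L hL ->]; apply: card_orbit_of_line.
  rewrite (card_in_imset orbit_of_line_inj); transitivity (size lines); last exact: l7.
  rewrite -(count_predT lines) -card_line_sets.
  by apply: eq_card => L; rewrite in_set andbT.
- move=> _ /imsetP[L hL ->] i x y; rewrite !mem_orbit_of_line -!mem_support_conj.
  by move=> /andP[_ /eqP ->] /andP[_ /eqP ->].
- move=> _ /imsetP[L hL ->]; have /imsetP[x xw e] := hL.
  transitivity #|L|; last by rewrite e card_support.
  by apply: eq_card => i; rewrite in_set (incident_line i hL).
- move=> i; rewrite (card_orbits_incident (P := fun l => nth false l i)).
    by apply/eqP/(allP p3); rewrite mem_iota ltn_ord.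
  by move=> L hL; rewrite (incident_line i hL) nth_bits7.
move=> i j nij; rewrite (card_orbits_incident (P := fun l => nth false l i && nth false l j)).
  have := allP (allP pp1 i _) j _; rewrite !mem_iota !ltn_ord => /(_ isT isT).
  by rewrite (inj_eq val_inj) (negPf nij) => /eqP.
by move=> L hL; rewrite (incident_line i hL) (incident_line j hL) !nth_bits7.
Qed.

Lemma beta_is_root i : beta i \in rootsE7.
Proof. by rewrite root_iso ?bt_root. Qed.

(** The sum and the difference of orthogonal roots have norm 4, whereas roots have norm 2. *)
Lemma beta_strongly_orthogonal i j : i != j ->
  [/\ ip (beta i) (beta j) = 0, beta i + beta j \notin rootsE7 & beta i - beta j \notin rootsE7].
Proof.
move=> nij; have o : ip (beta i) (beta j) = 0.
  by rewrite /beta ip_iso // ip_q q_bt (negPf nij) mul0r.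
have o' : ip (beta j) (beta i) = 0 by rewrite ipC.
have bi := ip_root (beta_is_root i); have bj := ip_root (beta_is_root j).
split; first exact: o.
  by apply/negP => /ip_root; rewrite ipDl !ipDr bi bj o o' => /eqP.
apply/negP => /ip_root; rewrite ipDl 2!ipDr 2!ipNl 2!ipNr bi bj o o' oppr0 opprK addr0 add0r => /eqP.
by [].
Qed.

Lemma conj_generated : M = <<[set reflp (beta i) | i : 'I_7]>>%g.
Proof.
rewrite /M /= -genJ; congr <<_>>%g; apply/setP => g; apply/imsetP/imsetP => [[h]|[i _ ->]].
  by case/imsetP => i _ -> ->; exists i; rewrite // reflp_conj ?bt_root.
by exists (rf i); rewrite ?imset_f // reflp_conj ?bt_root.
Qed.

(** A root with the frame roots all orthogonal to it would have the same products with them as its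
    opposite, so some frame root is moved by the reflection. Being sent to its opposite, that frame
    root is proportional to [x]. *)
Lemma reflections_in_M0 x : val x \in rootsE7 -> reflp (val x) \in M0 ->
  exists i, x = bt i \/ x = neg (bt i).
Proof.
move=> hx /M0P[_ h].
have [i qi] : exists i, q (bt i) x != 0.
  apply/existsP; apply: contraTT isT => /existsPn h0.
  have e i : q x (bt i) = q (neg x) (bt i).
    by rewrite q_negl qC; have := h0 i; rewrite negbK => /eqP ->; rewrite oppr0.
  have := eq_on_frame e => en.
  by have := q_negl x x; rewrite -en q_root.
have bi := bt_root i; have := h i.
have e : val (reflp (val x) (bt i)) = val (bt i) - ip (val (bt i)) (val x) *: val x.
  by rewrite reflpE // reflE.
have ni : ip (val (bt i)) (val x) != 0.
  by rewrite ip_q mulf_eq0 intr_eq0 (negPf qi).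
case/pairP => ee; move: e; rewrite ee.
  move=> /eqP; rewrite -subr_eq0 opprB addrC subrK scaler_eq0 (negPf ni) orFb => /eqP v0.
  by have := ip_root hx; rewrite v0 -(scale0r 0) ipZl mul0r.
rewrite val_neg => e2; set c := ip _ _ in e2 ni.
have e3 : c *: val x = 2%:R *: val (bt i).
  by rewrite scaler_nat mulr2n -[X in _ = _ + X]opprK e2 opprB addrC subrK.
(* Both roots have norm 2, so comparing norms in [e3] leaves c = 2 or c = -2. *)
have c2 : c * c = 2%:R * 2%:R.
  have := congr1 (fun u => ip u u) e3; rewrite !ipE !ip_root // => h2.
  by apply: (@mulIf _ 2%:R) => //; rewrite -mulrA h2 -mulrA.
exists i; have /eqP := c2; rewrite -!expr2 eqf_sqr => /orP[] /eqP ec; [left|right];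
  apply: val_inj; apply: (@scalerI _ _ c) => //; rewrite ?val_neg e3 ec ?scaleNr ?scalerN ?opprK //.
Qed.

Lemma reflections_in_conj b : b \in rootsE7 -> reflp b \in M ->
  exists i, reflp b = reflp (beta i).
Proof.
move=> hb; have hX : b \in rootsE7 ++ weights56 by rewrite mem_cat hb.
pose x : X := SeqSub hX; have xb : val x = b by [].
rewrite -xb in hb *; have hx' : val ((w^-1)%g x) \in rootsE7 by rewrite root_iso.
have e : reflp (val x) = (reflp (val ((w^-1)%g x)) ^ w)%g by rewrite reflp_conj // permKV.
rewrite e memJ_conjg => /(reflections_in_M0 hx')[i hi]; exists i.
rewrite /beta -(reflp_conj hw (bt_root i)); apply: (congr1 (fun g => (g ^ w)%g)).
case: hi => -> //; rewrite val_neg reflp_opp ?bt_root // -val_neg root_normE q_negl q_negr opprK.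
by rewrite -root_normE bt_root.
Qed.
End Incidence.

(** * The action of PSL(2,7) *)

Definition coord_perm (s : {perm 'I_8}) (v : vec) : vec := \row_k v 0 ((s^-1)%g k).

Lemma coord_permM s t v : coord_perm (s * t)%g v = coord_perm t (coord_perm s v).
Proof. by apply/rowP => k; rewrite !mxE invMg permM. Qed.

Lemma coord_perm1 v : coord_perm 1 v = v.
Proof. by apply/rowP => k; rewrite !mxE invg1 perm1. Qed.

Lemma coord_perm_unitv s i : coord_perm s (unitv i) = unitv (s i).
Proof. by apply/rowP => k; rewrite !mxE (canF_eq (permK s)). Qed.

Lemma coord_perm_shvec s A c : coord_perm s (shvec A c) = shvec (s @: A) c.
Proof.
apply/rowP => k; rewrite !mxE; congr (_%:R - _); congr (nat_of_bool _).
by rewrite -{2}(permKV s k) mem_imset //; apply: perm_inj.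
Qed.

Lemma unitv_root i j : i != j -> unitv i - unitv j \in rootsE7.
Proof.
move=> nij; rewrite /rootsE7 mem_cat; apply/orP; left; apply/allpairsPdep; exists i, j.
by rewrite mem_filter !mem_enum eq_sym nij.
Qed.

Lemma shvec_root (A : {set 'I_8}) : #|A| = 4%N -> shvec A 2%:R^-1 \in rootsE7.
Proof.
move=> cA; rewrite /rootsE7 mem_cat; apply/orP; right; apply/mapP; exists A => //.
by rewrite mem_enum inE cA.
Qed.

Lemma coord_perm_mem s v : v \in rootsE7 ++ weights56 -> coord_perm s v \in rootsE7 ++ weights56.
Proof.
rewrite mem_cat => /orP[|].
  rewrite /rootsE7 mem_cat => /orP[/allpairsPdep[i [j [_]]]|/mapP[A]].
    rewrite mem_filter => /andP[nji _] ->; rewrite mem_cat; apply/orP; left.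
    rewrite (_ : coord_perm _ _ = unitv (s i) - unitv (s j)); last first.
      by rewrite -!coord_perm_unitv; apply/rowP => k; rewrite !mxE.
    by apply: unitv_root; rewrite (inj_eq perm_inj) eq_sym.
  rewrite mem_enum inE => /eqP cA ->; rewrite mem_cat coord_perm_shvec shvec_root //.
  by rewrite card_imset //; apply: perm_inj.
case/allpairsPdep => a [A [ha]]; rewrite mem_enum inE => /eqP cA ->.
rewrite mem_cat; apply/orP; right; apply/allpairsPdep; exists a, (s @: A); split=> //.
  by rewrite mem_enum inE card_imset ?cA //; apply: perm_inj.
by rewrite -coord_perm_shvec; apply/rowP => k; rewrite !mxE.
Qed.

Definition coord_fun (s : {perm 'I_8}) (x : X) : X := SeqSub (coord_perm_mem s (valP x)).

Lemma coord_fun_inj s : injective (coord_fun s).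
Proof.
move=> x y /(congr1 val) /= e; apply: val_inj.
by rewrite -(coord_perm1 (val x)) -(mulgV s) coord_permM e -coord_permM mulgV coord_perm1.
Qed.

Definition coord_action (s : {perm 'I_8}) : {perm X} := perm (@coord_fun_inj s).

Lemma val_coord_action s x : val (coord_action s x) = coord_perm s (val x).
Proof. by rewrite permE. Qed.

Lemma coord_actionM : {morph coord_action : s t / (s * t)%g}.
Proof. by move=> s t; apply/permP => x; apply: val_inj; rewrite permM !val_coord_action coord_permM. Qed.

Lemma coord_action_tperm i j : i != j -> coord_action (tperm i j) = reflp (unitv i - unitv j).
Proof.
move=> nij; have hr := unitv_root nij; apply/permP => x; apply: val_inj.
rewrite val_coord_action reflpE // reflE //; move: (val x) => v.
have ipu k : ip v (unitv k) = v 0 k.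
  rewrite /ip (bigD1 k) //= big1 ?addr0 => [|l nl]; first by rewrite mxE eqxx mulr1.
  by rewrite mxE eq_sym (negPf nl) mulr0.
apply/rowP => k; rewrite ipDr ipNr !ipu !mxE tpermV.
by case: tpermP => [->|->|/eqP ki /eqP kj]; rewrite ?eqxx ?(negPf nij) 1?[j == i]eq_sym ?(negPf nij)
  1?[i == k]eq_sym 1?[j == k]eq_sym ?(negPf ki) ?(negPf kj) /=; ring.
Qed.

(** Transpositions of coordinates are the reflections in the roots [unitv i - unitv j]; they make
    the symmetric group on the coordinates the subgroup W(A7) of W. *)
Lemma coord_action_W s : coord_action s \in WE7.
Proof.
have [ts -> /allP h] := prod_tpermP s; elim: ts h => [|t ts IH] h.
  rewrite big_nil (_ : coord_action 1%g = 1%g) //.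
  by apply: (mulgI (coord_action 1%g)); rewrite -coord_actionM !mulg1.
rewrite big_cons coord_actionM groupM //; last by apply: IH => u hu; apply: h; rewrite inE hu orbT.
by rewrite coord_action_tperm ?reflp_W ?unitv_root //; apply: h; rewrite inE eqxx.
Qed.

(** * The projective line over F_7 and its Moebius transformations *)

Local Notation F7 := 'F_7.
Local Notation GL := {'GL_2[F7]}.

(* Homogeneous coordinates (k : 1), with oo = 7 as (1 : 0). *)
Definition homog (k : 'I_8) : 'rV[F7]_2 :=
  \row_(j < 2) (if j == 0 then (if val k == 7%N then 1 else (val k)%:R)
               else if val k == 7%N then 0 else 1).

Definition ratio (n m : F7) : 'I_8 := if m == 0 then inord 7 else inord (n / m : F7).
Definition point (v : 'rV[F7]_2) : 'I_8 := ratio (v 0 0) (v 0 1).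

Lemma F7_lt (x : F7) : (x < 7)%N.
Proof. exact: (ltn_ord x). Qed.

Lemma val_inord7 (x : F7) : val (inord x : 'I_8) = x.
Proof. by rewrite /= inordK // ltnW // ltnS; have := F7_lt x. Qed.

Lemma homogE k : (homog k 0 0 = if val k == 7%N then 1 else (val k)%:R) *
  (homog k 0 1 = if val k == 7%N then 0 else 1).
Proof. by split; rewrite mxE. Qed.

Lemma point_homog k : point (homog k) = k.
Proof.
apply: val_inj; rewrite /point /ratio !homogE.
case: (eqVneq (val k) 7%N) => [e|ne]; first by rewrite eqxx e /= inordK.
have lk : (val k < 7)%N by have := ltn_ord k; rewrite ltnS leq_eqVlt (negPf ne).
by rewrite oner_eq0 divr1 (val_inord7 (val k)%:R) val_Fp_nat // modn_small.
Qed.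

Lemma point_scale c v : c != 0 -> point (c *: v) = point v.
Proof.
move=> nc; rewrite /point /ratio !mxE mulf_eq0 (negPf nc) orFb.
by case: (eqVneq (v 0 1) 0) => // nv; rewrite -mulf_div divff // mul1r.
Qed.

Lemma row2P (u v : 'rV[F7]_2) : u 0 0 = v 0 0 -> u 0 1 = v 0 1 -> u = v.
Proof.
move=> e0 e1; apply/rowP => -[[|[|//]] h].
  by rewrite (_ : Ordinal h = 0) //; apply: val_inj.
by rewrite (_ : Ordinal h = 1) //; apply: val_inj.
Qed.

Lemma homog_point v : v != 0 -> exists2 c, c != 0 & v = c *: homog (point v).
Proof.
move=> nv; rewrite /point /ratio; case: (eqVneq (v 0 1) 0) => [v1|nv1].
  have i7 : val (inord 7 : 'I_8) = 7%N by apply: inordK.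
  exists (v 0 0).
    by apply: contra nv => /eqP v0; apply/eqP/row2P; rewrite ?v0 ?v1 mxE.
  by apply: row2P; rewrite mxE homogE i7 eqxx ?mulr1 ?mulr0.
exists (v 0 1) => //.
have i7 : (val (inord (v 0 0 / v 0 1 : F7) : 'I_8) == 7%N) = false.
  by rewrite val_inord7; apply/ltn_eqF/F7_lt.
apply: row2P; rewrite mxE homogE i7 ?mulr1 //.
by rewrite val_inord7 natr_Zp mulrC divfK.
Qed.

Lemma homog_neq0 k : homog k != 0.
Proof.
apply/eqP => /rowP h; have := h 0; have := h 1; rewrite !mxE.
by rewrite /=; case: ifP => // _ /eqP; rewrite oner_eq0.
Qed.

Lemma mul_GL_neq0 (v : 'rV[F7]_2) (g : GL) : v != 0 -> v *m GLval g != 0.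
Proof.
apply: contra => /eqP e; apply/eqP.
have ug : GLval g \in unitmx by case: g {e}.
by rewrite -(mulmxK ug v) e mul0mx.
Qed.

(** Matrices act on row vectors from the right, which matches the order of multiplication of
    permutations and makes [moebius] a morphism. *)
Definition moebius_fun (g : GL) (k : 'I_8) : 'I_8 := point (homog k *m GLval g).

Lemma moebius_funM g h k : moebius_fun (g * h)%g k = moebius_fun h (moebius_fun g k).
Proof.
rewrite /moebius_fun; have [c nc e] := homog_point (mul_GL_neq0 g (homog_neq0 k)).
have -> : GLval (g * h)%g = GLval g *m GLval h by [].
by rewrite mulmxA {1}e -scalemxAl point_scale.
Qed.

Lemma moebius_fun1 k : moebius_fun 1 k = k.
Proof.
rewrite /moebius_fun (_ : GLval 1%g = 1%:M) ?mulmx1 ?point_homog //.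
Qed.

Lemma moebius_inj g : injective (moebius_fun g).
Proof.
move=> k l e; rewrite -(moebius_fun1 k) -(moebius_fun1 l) -(mulgV g) !moebius_funM.
by rewrite e.
Qed.

Definition moebius (g : GL) : {perm 'I_8} := perm (@moebius_inj g).

Lemma moebiusM : {morph moebius : g h / (g * h)%g}.
Proof. by move=> g h; apply/permP => k; rewrite permM !permE moebius_funM. Qed.

Definition weyl_of_GL (g : GL) : {perm X} := coord_action (moebius g).

Lemma weyl_of_GLM : {morph weyl_of_GL : g h / (g * h)%g}.
Proof. by move=> g h; rewrite /weyl_of_GL moebiusM coord_actionM. Qed.

Lemma weyl_of_GL_W g : weyl_of_GL g \in WE7.
Proof. exact: coord_action_W. Qed.

(* Residues modulo 7 are represented by naturals, so that statements on the 336 elements of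
   SL(2,7) can be checked by computation. *)
Definition mat := (nat * nat * nat * nat)%type.

(** The list holds the inverses modulo 7, and the value 7 is the point at infinity. *)
Definition nratio (n m : nat) : nat :=
  let r := (m %% 7)%N in
  if eqn r 0 then 7%N else ((n * nth 0 [:: 0; 1; 4; 5; 2; 3; 6] r) %% 7)%N.

Definition nmoebius (m : mat) (k : nat) : nat :=
  let: (a, b, c, d) := m in
  if (k == 7)%N then nratio a b else nratio (k * a + c) (k * b + d).

(** The factor 6 stands for -1 modulo 7. *)
Definition has_det1 (m : mat) : bool :=
  let: (a, b, c, d) := m in ((a * d + 6 * (b * c)) %% 7 == 1)%N.
Definition residue_pairs : seq (nat * nat) := [seq (a, b) | a <- iota 0 7, b <- iota 0 7].
Definition sl2_list : seq mat :=
  [seq m <- [seq (p.1, p.2, r.1, r.2) | p <- residue_pairs, r <- residue_pairs] | has_det1 m].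

(** Complementing a four-element set negates its root, so [e] is the sign with which root [t] is
    carried to root [u]. *)
Definition frame_image (ps : seq nat) (t u : nat) (e : bool) : bool :=
  let bu := beta_bits u in let b := beta_bits t in
  all (fun k => eqb (nth false bu (nth 0%N ps k)) (nth false b k (+) e)) (iota 0 8).
Definition image_index (m : mat) (t : nat) : nat :=
  let ps := [seq nmoebius m k | k <- iota 0 8] in
  find (fun u => if frame_image ps t u false then true else frame_image ps t u true) (iota 0 7).

(** The value 7 would mean that no frame root is hit up to sign; this is the computation showing
    that SL(2,7) preserves the frame. *)
Lemma image_index_lt : all (fun m => all (fun t => image_index m t < 7)%N (iota 0 7)) sl2_list.
Proof. by vm_compute. Qed.

Definition scalar_mat (m : mat) : bool :=
  let: (a, b, c, d) := m in if eqn b 0 then if eqn c 0 then eqn a d else false else false.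
Lemma trivial_image_scalar : all (fun m =>
  if all (fun t => eqn (image_index m t) t) (iota 0 7) then scalar_mat m else true) sl2_list.
Proof. by vm_compute. Qed.

Definition collinear (i j k : nat) : bool :=
  has (fun l => [&& nth false l i, nth false l j & nth false l k]) lines.
Lemma not_collinear_012 : ~~ collinear 0 1 2.
Proof. by vm_compute. Qed.

Definition triple_eqb (p r : nat * nat * nat) : bool :=
  if eqn p.1.1 r.1.1 then if eqn p.1.2 r.1.2 then eqn p.2 r.2 else false else false.
Lemma triple_eqbP a b c a' b' c' :
  triple_eqb (a, b, c) (a', b', c') -> [/\ a = a', b = b' & c = c'].
Proof. by rewrite /triple_eqb !eqnE /=; do 2![case: eqP => // ->]; move/eqP. Qed.

(** There are 7 * 6 * 4 = 168 ordered triangles, which is the order of PSL(2,7); each is reached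
    from the triangle 0, 1, 2. *)
Lemma triangles_transitive :
  let im := [seq (image_index m 0, image_index m 1, image_index m 2) | m <- sl2_list] in
  all (fun i => all (fun j => all (fun k =>
    if uniq [:: i; j; k] then if collinear i j k then true else lazy_has (triple_eqb (i, j, k)) im
    else true) (iota 0 7)) (iota 0 7)) (iota 0 7).
Proof. by vm_compute. Qed.

Opaque sl2_list image_index.

Lemma beta_code_nth t k : (k < 8)%N ->
  nth 0 (beta_code t) k = if nth false (beta_bits t) k then Posz 2 else Negz 1.
Proof. by move=> lk; rewrite /beta_code /two_val (nth_map false) // size_mkseq. Qed.

Lemma weyl_of_GL_image g m (t u : 'I_7) e :
  (forall k : 'I_8, val (moebius g k) = nmoebius m k) ->
  frame_image [seq nmoebius m k | k <- iota 0 8] t u e ->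
  weyl_of_GL g (bt t) = if e then neg (bt u) else bt u.
Proof.
move=> gm /allP h; have e8 k (lk : (k < 8)%N) : nth false (beta_bits u) (nmoebius m k) =
    nth false (beta_bits t) k (+) e.
  have := h k; rewrite mem_iota => /(_ lk); rewrite (nth_map 0%N) ?size_iota // nth_iota // add0n.
  by move/eqP.
apply: val_inj; rewrite val_coord_action.
have vb i : val (bt i) = dec (beta_code i) by rewrite -dec_cd cd_bt.
have -> : val (if e then neg (bt u) else bt u) = if e then - val (bt u) else val (bt u).
  by case: e {e8 h}; rewrite ?val_neg.
rewrite !vb; apply/rowP => k; set l := (moebius g)^-1%g k.
have lk : val k = nmoebius m l by rewrite -gm permKV.
have := e8 l (ltn_ord l); rewrite -lk => eb.
rewrite mxE mxE beta_code_nth // -/l.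
have -> : (if e then - dec (beta_code u) else dec (beta_code u)) 0 k =
    (if e then - (nth 0 (beta_code u) k)%:~R else (nth 0 (beta_code u) k)%:~R) / 4%:R.
  by case: e {e8 h eb}; rewrite !mxE ?mulNr.
rewrite beta_code_nth ?ltn_ord // eb.
by case: (nth false _ l); case: e {e8 h eb}.
Qed.

Definition mat_of (g : GL) : mat :=
  (val (GLval g 0 0), val (GLval g 0 1), val (GLval g 1 0), val (GLval g 1 1)).

Lemma F7_inv (x : F7) : x != 0 -> x^-1 = (nth 0 [:: 0; 1; 4; 5; 2; 3; 6] (val x))%N%:R.
Proof.
by case: x => [[|[|[|[|[|[|[|x]]]]]]] h] // _; apply: val_inj; vm_compute.
Qed.

Lemma val_ratio (n m : nat) : val (ratio n%:R m%:R) = nratio n m.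
Proof.
have v k : val (k%:R : F7) = (k %% 7)%N := val_Fp_nat (isT : prime 7) k.
rewrite /ratio /nratio eqnE; have -> : ((m%:R : F7) == 0) = (m %% 7 == 0)%N by rewrite -v.
case: ifP => [_|m0]; first exact: inordK.
have nm : (m%:R : F7) != 0 by rewrite -(inj_eq val_inj) v m0.
rewrite val_inord7 (F7_inv nm) v.
by rewrite -natrM; exact: v.
Qed.

Lemma mul_row2 (v : 'rV[F7]_2) (A : 'M[F7]_2) j : (v *m A) 0 j = v 0 0 * A 0 j + v 0 1 * A 1 j.
Proof.
rewrite mxE !big_ord_recl big_ord0 addr0.
by rewrite (_ : lift ord0 ord0 = 1) //; apply: val_inj.
Qed.

Lemma val_moebius g k : val (moebius g k) = nmoebius (mat_of g) k.
Proof.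
rewrite permE /moebius_fun /point !mul_row2 !homogE /nmoebius /mat_of.
have n i j : GLval g i j = (val (GLval g i j))%:R by rewrite natr_Zp.
set a := \val (GLval g 0 0); set b := \val (GLval g 0 1).
set c := \val (GLval g 1 0); set d := \val (GLval g 1 1).
have ea : GLval g 0 0 = a%:R := n 0 0; have eb : GLval g 0 1 = b%:R := n 0 1.
have ec : GLval g 1 0 = c%:R := n 1 0; have ed : GLval g 1 1 = d%:R := n 1 1.
rewrite ea eb ec ed; case: ifP => k7; first by rewrite !mul1r !mul0r !addr0 val_ratio.
by rewrite !mul1r -!natrM -!natrD val_ratio.
Qed.

Lemma det2 (R : comNzRingType) (A : 'M[R]_2) : \det A = A 0 0 * A 1 1 - A 0 1 * A 1 0.
Proof.
rewrite (expand_det_row _ 0) !big_ord_recl big_ord0 addr0 /cofactor !det_mx11 !mxE.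
rewrite /= !expr0 expr1 mul1r mulN1r mulrN.
by congr (_ * A _ _ - A _ _ * A _ _); apply: val_inj.
Qed.

Lemma SL27P (g : GL) : reflect (\det (GLval g) = 1) (g \in SL27).
Proof.
apply: (iffP idP) => [|h]; last by apply: mem_gen; rewrite inE h.
have gs : group_set [set g : GL | \det (GLval g) == 1].
  apply/group_setP; split=> [|x y]; rewrite !inE; first by rewrite det1.
  by move=> /eqP hx /eqP hy; rewrite [GLval _]/(GLval x *m GLval y) det_mulmx hx hy mulr1.
by rewrite /SL27 /= (gen_set_id gs) inE => /eqP.
Qed.

Lemma mem_residue_pairs a b : (a < 7)%N -> (b < 7)%N -> (a, b) \in residue_pairs.
Proof. by move=> ha hb; apply/allpairsP; exists (a, b); rewrite !mem_iota ha hb. Qed.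

Lemma mat_of_sl2 (g : GL) : g \in SL27 -> mat_of g \in sl2_list.
Proof.
move=> /SL27P; rewrite det2 => h.
Transparent sl2_list. rewrite mem_filter; apply/andP; split; last first.
  apply/allpairsP; exists ((val (GLval g 0 0), val (GLval g 0 1)),
    (val (GLval g 1 0), val (GLval g 1 1))).
  by split; rewrite ?mem_residue_pairs ?F7_lt.
Opaque sl2_list.
rewrite /has_det1 /mat_of; set a := \val (GLval g 0 0); set b := \val (GLval g 0 1).
set c := \val (GLval g 1 0); set d := \val (GLval g 1 1).
have v k : val (k%:R : F7) = (k %% 7)%N := val_Fp_nat (isT : prime 7) k.
have n i j : GLval g i j = (val (GLval g i j))%:R by rewrite natr_Zp.
have ea : GLval g 0 0 = a%:R := n 0 0; have eb : GLval g 0 1 = b%:R := n 0 1.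
have ec : GLval g 1 0 = c%:R := n 1 0; have ed : GLval g 1 1 = d%:R := n 1 1.
rewrite -v natrD !natrM -ea -eb -ec -ed (_ : 6%:R = -1) ?mulN1r ?h //.
exact: val_inj.
Qed.

Lemma residue_pairs_lt p : p \in residue_pairs -> (p.1 < 7)%N /\ (p.2 < 7)%N.
Proof.
by case/allpairsP => -[a b] [ha hb ->]; rewrite !mem_iota in ha hb; case/andP: ha; case/andP: hb.
Qed.

Lemma sl2_list_mat m : m \in sl2_list -> exists2 g, g \in SL27 & mat_of g = m.
Proof.
Transparent sl2_list. rewrite mem_filter => /andP[dm /allpairsP[[[a b] [c d]] [h1 h2 e]]].
Opaque sl2_list.
have [/= la lb] := residue_pairs_lt h1; have [/= lc ld] := residue_pairs_lt h2.
rewrite e in dm *; rewrite [has_det1 _]/= in dm.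
have v k : val (k%:R : F7) = (k %% 7)%N := val_Fp_nat (isT : prime 7) k.
pose A : 'M[F7]_2 := \matrix_(i < 2, j < 2)
  (if i == 0 then if j == 0 then a%:R else b%:R else if j == 0 then c%:R else d%:R).
have A00 : A 0 0 = a%:R by rewrite mxE.
have A01 : A 0 1 = b%:R by rewrite mxE.
have A10 : A 1 0 = c%:R by rewrite mxE.
have A11 : A 1 1 = d%:R by rewrite mxE.
have v1 : (a * d + 6 * (b * c))%:R = 1 :> F7 by apply: val_inj; rewrite v (eqP dm).
have dA : \det A = 1.
  rewrite det2 A00 A01 A10 A11 -[RHS]v1 natrD !natrM.
  by rewrite [X in _ = _ + X * _](_ : _ = -1 :> F7) ?mulN1r //; apply: val_inj.
have uA : A \is a GRing.unit by rewrite unitmxE dA unitr1.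
exists (FinRing.Unit uA); first exact/SL27P.
rewrite /mat_of -[GLval _]/A A00 A01 A10 A11.
by rewrite (v a) (v b) (v c) (v d) !modn_small.
Qed.

(** * The normaliser modulo the sign changes *)

Lemma pair_eq i j x : x \in pair i -> x \in pair j -> i = j.
Proof. by case/pairP => ->; rewrite ?pair_neg pair_bt => /eqP. Qed.

Lemma weyl_of_GL_bt g (t : 'I_7) : g \in SL27 ->
  exists2 u : 'I_7, val u = image_index (mat_of g) t & weyl_of_GL g (bt t) \in pair u.
Proof.
move=> hg; have lt : (image_index (mat_of g) t < 7)%N.
  by apply: (allP (allP image_index_lt _ (mat_of_sl2 hg))); rewrite mem_iota ltn_ord.
exists (Ordinal lt) => //.
have hs : has (fun u => if frame_image [seq nmoebius (mat_of g) k | k <- iota 0 8] t u false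
  then true else frame_image [seq nmoebius (mat_of g) k | k <- iota 0 8] t u true) (iota 0 7).
  by rewrite has_find.
have := nth_find 0%N hs; rewrite -/(image_index (mat_of g) t) (nth_iota _ _ lt) add0n.
case: ifP => [h _|_ h].
  by rewrite (@weyl_of_GL_image g _ t (Ordinal lt) false (val_moebius g) h) pair_bt.
by rewrite (@weyl_of_GL_image g _ t (Ordinal lt) true (val_moebius g) h) pair_neg pair_bt.
Qed.

(** A normalising element permutes the reflections in [M0], and by [reflections_in_M0] these are the
    frame reflections only; conversely, permuting them preserves the group that they generate. *)
Lemma normal_M0P (g : {perm X}) :
  reflect (g \in WE7 /\ stabilizes_frame g) (g \in 'N_WE7(M0)%g).
Proof.
apply: (iffP setIP) => -[gW gN]; split=> //.
  move=> i; have : (rf i ^ g)%g \in M0 by rewrite memJ_norm // mem_gen // imset_f.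
  rewrite (reflp_conj gW (bt_root i)) => h.
  have hr : val (g (bt i)) \in rootsE7 by rewrite (root_iso _ gW) bt_root.
  by have [j hj] := reflections_in_M0 hr h; exists j; apply/pairP.
rewrite inE -genJ gen_subG; apply/subsetP => _ /imsetP[_ /imsetP[i _ ->] ->].
rewrite (reflp_conj gW (bt_root i)); have [j /pairP hj] := gN i.
have -> : reflp (val (g (bt i))) = rf j; last by rewrite mem_gen // imset_f.
case: hj => -> //; rewrite val_neg reflp_opp ?bt_root // -val_neg root_normE q_negl q_negr opprK.
by rewrite -root_normE bt_root.
Qed.

Lemma weyl_of_GL_normal g : g \in SL27 -> weyl_of_GL g \in 'N_WE7(M0)%g.
Proof.
move=> hg; apply/normal_M0P; split=> [|i]; first exact: weyl_of_GL_W.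
by have [u _ hu] := weyl_of_GL_bt i hg; exists u.
Qed.

Definition o0 : 'I_7 := Ordinal (isT : 0 < 7)%N.
Definition o1 : 'I_7 := Ordinal (isT : 1 < 7)%N.
Definition o2 : 'I_7 := Ordinal (isT : 2 < 7)%N.

(** Lines come from weights, and W permutes the weights; a line through the images pulls back to a
    line through 0, 1, 2. *)
Lemma frame_not_collinear (n : {perm X}) i j k : n \in WE7 ->
  n (bt o0) \in pair i -> n (bt o1) \in pair j -> n (bt o2) \in pair k -> ~~ collinear i j k.
Proof.
move=> nW h0 h1 h2; apply: contra not_collinear_012 => /hasP[l hl].
have [y yw ->] := lines_support hl; rewrite !nth_bits7.
rewrite -(permKV n y) (support_iso _ nW h0) (support_iso _ nW h1) (support_iso _ nW h2).
move=> h; apply/hasP; exists (bits7 (weight_line ((n^-1)%g y))).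
  by apply: support_lines; rewrite weight_iso ?groupV.
by rewrite (nth_bits7 _ o0) (nth_bits7 _ o1) (nth_bits7 _ o2).
Qed.

(** The surjectivity onto the quotient: choose [g] with the same effect as [n] on the triangle 0, 1,
    2. The quotient of the two then fixes a triangle, and [fixed_triangle] applies. *)
Lemma normal_M0_factor (n : {perm X}) : n \in 'N_WE7(M0)%g ->
  exists2 g, g \in SL27 & (n * (weyl_of_GL g)^-1)%g \in M0.
Proof.
move=> nN; have [nW st] := normal_M0P _ nN.
have [i hi] := st o0; have [j hj] := st o1; have [k hk] := st o2.
have ncol := frame_not_collinear nW hi hj hk.
have un : uniq [:: val i; val j; val k].
  rewrite /= !inE negb_or !(inj_eq val_inj) andbT -andbA; apply/and3P; split; apply/eqP => e.
  - by have := pair_perm_inj nW hi (etrans (congr1 (fun i => n (bt o1) \in pair i) e) hj).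
  - by have := pair_perm_inj nW hi (etrans (congr1 (fun i => n (bt o2) \in pair i) e) hk).
  by have := pair_perm_inj nW hj (etrans (congr1 (fun i => n (bt o2) \in pair i) e) hk).
have := allP (allP (allP triangles_transitive i _) j _) k _.
rewrite !mem_iota !ltn_ord => /(_ isT isT isT); rewrite un (negPf ncol) lazy_hasE.
case/hasP => p /mapP[m hm ->] /triple_eqbP[ei ej ek].
have [g hg gm] := sl2_list_mat hm; exists g; first exact: hg.
have gN := weyl_of_GL_normal hg.
have hN : (n * (weyl_of_GL g)^-1)%g \in 'N_WE7(M0)%g by rewrite groupM ?groupV.
have [hW hst] := normal_M0P _ hN; apply: (fixed_triangle hW hst) => t t3.
have key (v u : 'I_7) : val u = image_index m v -> n (bt v) \in pair u ->
    (n * (weyl_of_GL g)^-1)%g (bt v) \in pair v.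
  move=> eu hu; have [u' eu' hu'] := weyl_of_GL_bt v hg.
  have {eu' eu} euu : u' = u by apply: val_inj; rewrite eu' gm eu.
  have [x hx] := hst v; rewrite euu in hu'; suff e : v = x by move: hx; rewrite -e.
  apply: (pair_perm_inj (weyl_of_GL_W g) hu').
  have e : n (bt v) = weyl_of_GL g ((n * (weyl_of_GL g)^-1)%g (bt v)) by rewrite permM permKV.
  move: hu; rewrite e; case/pairP: hx => ->; first exact: id.
  by rewrite (neg_iso _ (weyl_of_GL_W g)) pair_neg.
case: t t3 => [[|[|[|t]]] ht] t3; last by rewrite !ltnS ltn0 in t3.
- have -> : Ordinal ht = o0 by apply: val_inj.
  exact: (key o0 i ei hi).
- have -> : Ordinal ht = o1 by apply: val_inj.
  exact: (key o1 j ej hj).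
have -> : Ordinal ht = o2 by apply: val_inj.
exact: (key o2 k ek hk).
Qed.

Lemma trivial_on_frame g : g \in SL27 -> weyl_of_GL g \in M0 -> scalar_mat (mat_of g).
Proof.
move=> hg /M0P[_ h]; have := allP trivial_image_scalar _ (mat_of_sl2 hg).
suff -> : all (fun t => eqn (image_index (mat_of g) t) t) (iota 0 7) by [].
apply/allP => t; rewrite mem_iota => /andP[_ lt]; rewrite eqnE.
have [u eu hu] := weyl_of_GL_bt (Ordinal lt) hg.
by rewrite -[t]/(val (Ordinal lt)) -eu (pair_eq (h (Ordinal lt)) hu).
Qed.

Lemma row2_eq (A B : 'M[F7]_2) : A 0 0 = B 0 0 -> A 0 1 = B 0 1 -> A 1 0 = B 1 0 -> A 1 1 = B 1 1 ->
  A = B.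
Proof.
move=> e00 e01 e10 e11; apply/matrixP => i j.
have ord2 (k : 'I_2) : k = 0 \/ k = 1.
  by case: k => [[|[|//]] h]; [left|right]; apply: val_inj.
by case: (ord2 i) => ->; case: (ord2 j) => ->.
Qed.

Lemma mul_mx2 (A B : 'M[F7]_2) i j : (A *m B) i j = A i 0 * B 0 j + A i 1 * B 1 j.
Proof.
rewrite mxE !big_ord_recl big_ord0 addr0.
by rewrite (_ : lift ord0 ord0 = 1) //; apply: val_inj.
Qed.

Lemma scalar_matP g : scalar_mat (mat_of g) -> exists c, GLval g = c%:M.
Proof.
rewrite /scalar_mat /mat_of; case: ifP => // b0; case: ifP => // c0 ad.
rewrite !eqnE in b0 c0 ad; exists (GLval g 0 0).
by apply: row2_eq; rewrite !mxE //=; apply: val_inj; rewrite ?(eqP b0) ?(eqP c0) ?(eqP ad).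
Qed.

Lemma weyl_of_GL_scalar g c : GLval g = c%:M -> weyl_of_GL g = 1%g.
Proof.
move=> e; have e1 : moebius g = 1%g.
  apply/permP => k; rewrite permE perm1 /moebius_fun.
  have := mul_GL_neq0 g (homog_neq0 k); rewrite e mul_mx_scalar scaler_eq0 negb_or => /andP[nc _].
  by rewrite point_scale // point_homog.
rewrite /weyl_of_GL e1; apply: (mulgI (coord_action 1%g)).
by rewrite -coord_actionM !mulg1.
Qed.

Lemma transvections_sl2 : ((1, 1, 0, 1) \in sl2_list)%N && ((1, 0, 1, 1) \in sl2_list)%N.
Proof. by vm_compute. Qed.

(** Both sides amount to the matrix being scalar. Central elements commute with the two elementary
    transvections, which forces a scalar matrix, and scalars act trivially on the projective line;
    conversely, only scalars fix all the pairs of the frame. *)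
Lemma center_SL27 g : g \in SL27 -> (g \in 'Z(SL27)%g) = (weyl_of_GL g \in M0).
Proof.
move=> hg; apply/centerP/idP => [[_ cg]|hM]; last first.
  split=> // h _; have [c e] := scalar_matP (trivial_on_frame hg hM).
  apply: val_inj; change (GLval g *m GLval h = GLval h *m GLval g).
  by rewrite e scalar_mxC.
have /andP[/sl2_list_mat[U hU [u00 u01 u10 u11]] /sl2_list_mat[L hL [l00 l01 l10 l11]]] :=
  transvections_sl2.
have cU : GLval g *m GLval U = GLval U *m GLval g := congr1 (@GLval 2 _) (cg U hU).
have cL : GLval g *m GLval L = GLval L *m GLval g := congr1 (@GLval 2 _) (cg L hL).
have U00 : GLval U 0 0 = 1 by apply: val_inj; exact: u00.
have U01 : GLval U 0 1 = 1 by apply: val_inj; exact: u01.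
have U10 : GLval U 1 0 = 0 by apply: val_inj; exact: u10.
have U11 : GLval U 1 1 = 1 by apply: val_inj; exact: u11.
have L00 : GLval L 0 0 = 1 by apply: val_inj; exact: l00.
have L01 : GLval L 0 1 = 0 by apply: val_inj; exact: l01.
have L10 : GLval L 1 0 = 1 by apply: val_inj; exact: l10.
have L11 : GLval L 1 1 = 1 by apply: val_inj; exact: l11.
have c0 : GLval g 1 0 = 0.
  have /matrixP/(_ 0 0) := cU; rewrite !mul_mx2 U00 U01 U10 mulr1 mulr0 !mul1r addr0.
  by rewrite -[LHS]addr0 => /addrI.
have ad : GLval g 1 1 = GLval g 0 0.
  have /matrixP/(_ 0 1) := cU; rewrite !mul_mx2 U00 U01 U11 !mulr1 !mul1r addrC.
  by move/addrI.
have b0 : GLval g 0 1 = 0.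
  have /matrixP/(_ 0 0) := cL; rewrite !mul_mx2 L00 L01 L10 !mulr1 mul1r mul0r.
  by move/addrI.
have e : GLval g = (GLval g 0 0)%:M by apply: row2_eq; rewrite !mxE ?c0 ?b0 ?ad.
by rewrite (weyl_of_GL_scalar e) group1.
Qed.

(** The first isomorphism theorem for the map from SL(2,7) to the quotient: [center_SL27] gives its
    kernel and [normal_M0_factor] its image, both transported by [w]. *)
Lemma normal_quotient_PSL (M : {group {perm X}}) w : w \in WE7 -> M :=: (M0 :^ w)%g ->
  ('N_WE7(M) / M)%g \isog PSL27.
Proof.
move=> hw eM; have N_conj : 'N_WE7(M)%g = ('N_WE7(M0) :^ w)%g.
  by rewrite eM normJ conjIg conjGid.
pose f (g : GL) := coset M (weyl_of_GL g ^ w)%g.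
have fN g : g \in SL27 -> (weyl_of_GL g ^ w)%g \in 'N_WE7(M)%g.
  by move=> hg; rewrite N_conj memJ_conjg weyl_of_GL_normal.
have fN' g : g \in SL27 -> (weyl_of_GL g ^ w)%g \in 'N(M)%g by move=> /fN/setIP[].
have fM : {in SL27 &, {morph f : g h / (g * h)%g}}.
  move=> g h hg hh; rewrite /f weyl_of_GLM conjMg morphM ?fN' //.
pose F := Morphism fM.
have kerF : ('ker F = 'Z(SL27))%g.
  apply/setP => g; have [hg|nhg] := boolP (g \in SL27); last first.
    apply/idP/idP => [/(subsetP (subsetIl _ _))|/(subsetP (center_sub _))];
    by rewrite (negPf nhg).
  rewrite center_SL27 // -(memJ_conjg _ w) -eM.
  apply/kerP/idP => // [fg1|gM]; first by apply: coset_idr fg1; apply: fN'.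
  exact: coset_id.
have imF : (F @* SL27)%g = ('N_WE7(M) / M)%g.
  apply/setP => x; apply/morphimP/morphimP => [[g _ hg ->]|[n nN nW ->]].
    by exists (weyl_of_GL g ^ w)%g; rewrite ?fN ?fN'.
  have nM : (n ^ w^-1)%g \in 'N_WE7(M0)%g by rewrite -mem_conjg -N_conj.
  have [g hg hM] := normal_M0_factor nM; exists g => //; rewrite /= /f.
  have hM' : (n * (weyl_of_GL g ^ w)^-1)%g \in M.
    rewrite eM -(memJ_conjg _ w) in hM *.
    by rewrite conjMg conjVg -conjgM mulVg conjg1 in hM.
  apply/rcoset_kercosetP => //; first exact: fN'.
  by rewrite mem_rcoset.
have := first_isog F; rewrite kerF imF => iso; rewrite /PSL27.
by rewrite isog_sym.
Qed.

Theorem theorem4p5 (M : {group {perm X}}) :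
  M \subset WE7 -> abelian M ->
  (forall H : {group {perm X}}, H \subset WE7 -> abelian H -> (#|H| <= #|M|)%N) ->
  [/\ (2.-abelem M)%g, #|M| = (2 ^ 7)%N,
      exists beta : 'I_7 -> vec,
        let orbs := [set orbit 'P M x | x in weightX] in
        let inc i (O : {set X}) := [exists x in O, ip (beta i) (val x) != 0] in
        [/\ forall i, beta i \in rootsE7,
            forall i j, i != j ->
              [/\ ip (beta i) (beta j) = 0, beta i + beta j \notin rootsE7
                & beta i - beta j \notin rootsE7],
            (M :=: <<[set reflp (beta i) | i : 'I_7]>>)%g,
            forall b, b \in rootsE7 -> reflp b \in M ->
              exists i, reflp b = reflp (beta i)
          & [/\ #|orbs| = 7%N /\ (forall O, O \in orbs -> #|O| = 8%N),
                forall O, O \in orbs -> forall i, forall x y, x \in O -> y \in O ->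
                  (ip (beta i) (val x) != 0) = (ip (beta i) (val y) != 0),
                forall O, O \in orbs -> #|[set i | inc i O]| = 3%N,
                forall i, #|[set O in orbs | inc i O]| = 3%N
              & forall i j, i != j -> #|[set O in orbs | inc i O && inc j O]| = 1%N]]
    & ('N_WE7(M) / M)%g \isog PSL27].
Proof.
move=> sM abM maxM; have [w hw eM] := maximal_abelian_conj sM abM maxM.
split; last exact: normal_quotient_PSL hw eM.
- by rewrite eM abelemJ M0_abelem.
- by rewrite eM cardJg card_M0.
exists (beta w); cbv zeta; rewrite eM; split.
- exact: beta_is_root hw.
- exact: beta_strongly_orthogonal hw.
- exact: conj_generated hw.
- exact: reflections_in_conj hw.
exact: fano_plane hw.
Qed.
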